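(* There is a constant $C>0$, independent of $h$, $K$, $v_h$ and $\varphi$, such that for every $v_h\in V_h$, every $K\in\mathcal T_h$ and every weight function $\varphi\in W^{1,\infty}(K)$, $$\|v_h\varphi-i_h(v_h\varphi)\|_{L^2(K)}+h\|\nabla(v_h\varphi-i_h(v_h\varphi))\|_{L^2(K)}\le C\,h\,|\varphi|_{W^{1,\infty}(K)}\|v_h\|_{L^2(K)}.$$
   Context: $\mathcal T_h$ is a conforming triangulation, from a shape-regular family, of a planar polygonal domain $\Omega$ (the unit square) into triangles $K$ of diameter $h_K$; $h=\max_K h_K<1$. $V_h\subset H^1(\Omega)$ is the space of continuous functions that are affine on each $K\in\mathcal T_h$. $i_h$ is the Lagrange nodal interpolant: on $K$, $i_hw$ is the affine function agreeing with the continuous function $w$ at the vertices of $K$ (elements of $W^{1,\infty}(K)$ are identified with their Lipschitz continuous representatives). $|\varphi|_{W^{1,\infty}(K)}:=\|\nabla\varphi\|_{L^\infty(K)}$. The constant $C$ may depend on the shape-regularity of the mesh family. *)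

(* Defs.v *)
From HB Require Import structures.
From mathcomp Require Import all_boot all_order all_algebra.
From mathcomp Require Import all_classical all_reals all_analysis.
From mathcomp Require Import ring.
Set Implicit Arguments.
Unset Strict Implicit.
Unset Printing Implicit Defensive.
Import Order.TTheory GRing.Theory Num.Theory.
Import numFieldNormedType.Exports.

Local Open Scope classical_set_scope.
Local Open Scope ring_scope.

(* The library norm on R * R is the sup norm; its topology and its Lipschitz
   functions are the Euclidean ones, but lengths are measured with euclid. *)
Definition euclid (R : realType) (x : R * R) : R :=
  Num.sqrt (x.1 ^+ 2 + x.2 ^+ 2).

(* The Borel sigma-algebra is used: L^p functions are Borel representatives. *)
Definition lebesgue2 (R : realType) :
    {measure set (measurableTypeR R * measurableTypeR R) -> \bar R} :=
  (@lebesgue_measure R \x @lebesgue_measure R)%E.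

Section WeakGradient.
Variable R : realType.
Implicit Types (D : set (R * R)) (f : R * R -> R) (G : R * R -> R * R).

Definition partial1 f : R * R -> R := 'D_((1, 0) : R * R) f.
Definition partial2 f : R * R -> R := 'D_((0, 1) : R * R) f.

Fixpoint Ck (k : nat) f : Prop :=
  if k is m.+1 then
    [/\ continuous f,
        forall x, derivable f x ((1, 0) : R * R) /\
                  derivable f x ((0, 1) : R * R),
        Ck m (partial1 f) & Ck m (partial2 f)]
  else continuous f.

Definition test_function D f : Prop :=
  [/\ forall k, Ck k f,
      compact (closure [set x | f x != 0]) &
      closure [set x | f x != 0] `<=` D° ].

Definition locally_integrable2 D f : Prop :=
  measurable_fun (D : set (measurableTypeR R * measurableTypeR R)) f /\
  forall A, compact A -> A `<=` D° ->
    (@lebesgue2 R).-integrable A (EFin \o f).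

Definition is_weak_gradient D f G : Prop :=
  [/\ locally_integrable2 D f,
      locally_integrable2 D (fst \o G),
      locally_integrable2 D (snd \o G) &
      forall psi, test_function D psi ->
        (\int[@lebesgue2 R]_(x in D) (f x * partial1 psi x)) =
          (- (\int[@lebesgue2 R]_(x in D) ((G x).1 * psi x))) /\
        (\int[@lebesgue2 R]_(x in D) (f x * partial2 psi x)) =
          (- (\int[@lebesgue2 R]_(x in D) ((G x).2 * psi x)))].

Definition weakly_differentiable D f : Prop :=
  exists G, is_weak_gradient D f G.

(* Some representative of the weak gradient, which is unique almost everywhere
   on D°; it is 0 (a junk value) if f is not weakly differentiable. *)
Definition weak_gradient D f : R * R -> R * R :=
  xget (cst 0) [set G | is_weak_gradient D f G].

Definition Lnorm_on D (p : \bar R) f : \bar R :=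
  Lnorm (@lebesgue2 R) p (EFin \o (f \_ D)).

Definition grad_Lnorm_on D (p : \bar R) f : \bar R :=
  Lnorm_on D p (fun x => euclid (weak_gradient D f x)).

(* f stands for the Lipschitz representative of its class. *)
Definition in_W1oo D f : Prop :=
  [/\ [lipschitz f x | x in D],
      weakly_differentiable D f,
      (Lnorm_on D +oo f < +oo)%E &
      (grad_Lnorm_on D +oo f < +oo)%E].

End WeakGradient.

Record triangle (R : realType) := Triangle {
  vertex : 'I_3 -> R * R ;
  vertex_nondegenerate :
    let u := vertex 1 - vertex 0 in
    let v := vertex 2%:R - vertex 0 in
    u.1 * v.2 - u.2 * v.1 != 0 }.

Section Triangles.
Variable R : realType.
Implicit Types (K L : triangle R) (S : {set 'I_3}) (A : set (R * R)).

(* Convex hull of the vertices with index in S: empty, a vertex, a closed edge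
   or the whole closed triangle, according to #|S|. *)
Definition face K S : set (R * R) :=
  [set x | exists t : 'I_3 -> R,
    [/\ forall i, 0 <= t i, forall i, i \notin S -> t i = 0,
        \sum_i t i = 1 & x = \sum_i t i *: vertex K i]].

Definition triangle_set K : set (R * R) := face K [set: 'I_3]%SET.

Definition meet_conformingly K L : Prop :=
  exists S S' : {set 'I_3},
    [/\ (#|S| < 3)%N, (#|S'| < 3)%N,
        triangle_set K `&` triangle_set L = face K S & face K S = face L S'].

Definition diam A : R :=
  sup [set d | exists x y, [/\ A x, A y & d = euclid (x - y)]].

(* Diameter of the largest disc contained in A. *)
Definition indiam A : R :=
  sup [set d | exists c r, [/\ 0 <= r,
    [set x | euclid (x - c) <= r] `<=` A & d = 2 * r]].

Definition affine_on A (f : R * R -> R) : Prop :=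
  exists a b c : R, forall x, A x -> f x = a + b * x.1 + c * x.2.

Definition interpolates K (w p : R * R -> R) : Prop :=
  affine_on setT p /\ forall i, p (vertex K i) = w (vertex K i).

Definition lagrange_interpolant K (w : R * R -> R) : R * R -> R :=
  xget (cst 0) [set p | interpolates K w p].

Lemma lagrange_interpolantP K w : interpolates K w (lagrange_interpolant K w).
Proof.
apply: (@xgetPex _ (cst 0) [set p | interpolates K w p]).
case: K => v /= nd0; pose a := v 0; pose b := v 1; pose c := v 2%:R.
pose dt := (b - a).1 * (c - a).2 - (b - a).2 * (c - a).1.
have nd : dt != 0 := nd0.
pose l1 x := ((x.1 - a.1) * (c - a).2 - (x.2 - a.2) * (c - a).1) / dt.
pose l2 x := ((b - a).1 * (x.2 - a.2) - (b - a).2 * (x.1 - a.1)) / dt.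
exists (fun x => w a + (w b - w a) * l1 x + (w c - w a) * l2 x); split.
  exists (w a + (w b - w a) * l1 (0, 0) + (w c - w a) * l2 (0, 0)),
    ((w b - w a) * (c - a).2 / dt - (w c - w a) * (b - a).2 / dt),
    ((w c - w a) * (b - a).1 / dt - (w b - w a) * (c - a).1 / dt).
  by move=> x _; rewrite /l1 /l2 /=; ring.
have l1a : l1 a = 0 by rewrite /l1 !subrr !mul0r subrr mul0r.
have l2a : l2 a = 0 by rewrite /l2 !subrr !mulr0 subrr mul0r.
have l1b : l1 b = 1 by rewrite /l1 -[RHS](divff nd); congr (_ / _).
have l2b : l2 b = 0 by rewrite /l2 /=; apply/eqP;
  rewrite mulf_eq0 subr_eq0; apply/orP; left; rewrite mulrC.
have l1c : l1 c = 0 by rewrite /l1 /=; apply/eqP;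
  rewrite mulf_eq0 subr_eq0; apply/orP; left; rewrite mulrC.
have l2c : l2 c = 1 by rewrite /l2 -[RHS](divff nd); congr (_ / _).
move=> i; have : [\/ i = 0, i = 1 | i = 2%:R].
  case: i => -[|[|[|//]]] i3; [apply: Or31|apply: Or32|apply: Or33];
  exact: val_inj.
case=> -> /=; rewrite -/a -/b -/c ?l1a ?l2a ?l1b ?l2b ?l1c ?l2c; ring.
Qed.

Lemma interpolates_unique K w p q :
  interpolates K w p -> interpolates K w q -> p = q.
Proof.
case: K => v /= nd0; pose a := v 0; pose b := v 1; pose c := v 2%:R.
pose dt := (b - a).1 * (c - a).2 - (b - a).2 * (c - a).1.
have nd : dt != 0 := nd0.
move=> [[p0 [p1 [p2 pE]]] pv] [[q0 [q1 [q2 qE]]] qv].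
have E i : p0 + p1 * (v i).1 + p2 * (v i).2 = q0 + q1 * (v i).1 + q2 * (v i).2.
  by rewrite -pE// -qE// -[v i]/(vertex (Triangle nd0) i) pv qv.
have := E 0; have := E 1; have := E 2%:R; rewrite -/a -/b -/c => Ec Eb Ea.
have dtE : dt = (b.1 - a.1) * (c.2 - a.2) - (b.2 - a.2) * (c.1 - a.1) by [].
have h1 : (p1 - q1) * dt = 0.
  rewrite dtE; transitivity (
    ((p0 + p1 * b.1 + p2 * b.2) - (q0 + q1 * b.1 + q2 * b.2)
     - ((p0 + p1 * a.1 + p2 * a.2) - (q0 + q1 * a.1 + q2 * a.2)))
      * (c.2 - a.2) -
    ((p0 + p1 * c.1 + p2 * c.2) - (q0 + q1 * c.1 + q2 * c.2)
     - ((p0 + p1 * a.1 + p2 * a.2) - (q0 + q1 * a.1 + q2 * a.2)))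
      * (b.2 - a.2)); first by ring.
  by rewrite Ea Eb Ec; ring.
have h2 : (p2 - q2) * dt = 0.
  rewrite dtE; transitivity (
    ((p0 + p1 * c.1 + p2 * c.2) - (q0 + q1 * c.1 + q2 * c.2)
     - ((p0 + p1 * a.1 + p2 * a.2) - (q0 + q1 * a.1 + q2 * a.2)))
      * (b.1 - a.1) -
    ((p0 + p1 * b.1 + p2 * b.2) - (q0 + q1 * b.1 + q2 * b.2)
     - ((p0 + p1 * a.1 + p2 * a.2) - (q0 + q1 * a.1 + q2 * a.2)))
      * (c.1 - a.1)); first by ring.
  by rewrite Ea Eb Ec; ring.
move/eqP: h1; rewrite mulf_eq0 (negbTE nd) orbF subr_eq0 => /eqP h1.
move/eqP: h2; rewrite mulf_eq0 (negbTE nd) orbF subr_eq0 => /eqP h2.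
move: Ea; rewrite h1 h2 => /addIr /addIr h0.
by apply/funext => x; rewrite pE// qE// h0 h1 h2.
Qed.

End Triangles.

Record mesh (R : realType) (Omega : set (R * R)) := Mesh {
  mesh_card : nat ;
  element :> 'I_mesh_card -> triangle R ;
  mesh_cover : \bigcup_i triangle_set (element i) = closure Omega ;
  mesh_conforming : forall i j, i != j ->
    meet_conformingly (element i) (element j) }.

Definition unit_square (R : realType) : set (R * R) :=
  [set x | 0 < x.1 < 1 /\ 0 < x.2 < 1].

Section Meshes.
Variables (R : realType) (Omega : set (R * R)).
Implicit Types (T : mesh Omega) (F : set (mesh Omega)).

Definition mesh_size T : R :=
  \big[Num.max/0]_i diam (triangle_set (T i)).

(* A mesh family is given by the set of its members. *)
Definition shape_regular F : Prop :=
  exists sigma : R, forall T, F T -> forall i,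
    diam (triangle_set (T i)) <= sigma * indiam (triangle_set (T i)).

(* V_h; values outside the closure of Omega are irrelevant. *)
Definition fe_space T : set (R * R -> R) :=
  [set v | {within closure Omega, continuous v} /\
           forall i, affine_on (triangle_set (T i)) v].

End Meshes.

(* Main.v *)
Require Import Defs.
From HB Require Import structures.
From mathcomp Require Import all_boot all_order all_algebra.
From mathcomp Require Import all_classical all_reals all_analysis.
From mathcomp Require Import measurable_realfun ess_sup_inf ring lra.
Set Implicit Arguments.
Unset Strict Implicit.
Unset Printing Implicit Defensive.

Import Order.TTheory GRing.Theory Num.Theory.
Import numFieldNormedType.Exports.

Local Open Scope classical_set_scope.
Local Open Scope ring_scope.

(** Write M for the essential bound on the weak gradient of phi over the
    triangle K, h_K for the diameter of K, V for the largest nodal value of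
    |v| on K, and phi_0 for the value of phi at a vertex.  Interpolation is
    linear and reproduces affine functions, so phi may be replaced by
    phi - phi_0:

      w = v (phi - phi_0) - q,   q affine,   q = v (phi - phi_0) at the vertices.

    Everything follows from the oscillation bound |phi - phi_0| <= M h_K on K.
    An affine function is bounded on K by its nodal values, whence
    |w| <= 2 V M h_K; its gradient is bounded by the largest nodal value divided
    by the radius r of a disc inside K, and shape regularity gives
    h_K <= 4 sigma r; hence grad w = v grad phi + (phi - phi_0) grad v - grad q
    is bounded by (1 + 8 sigma) V M almost everywhere.  The L^2 norms over K cost
    a factor of order h_K.  Conversely V r / 8 <= ||v||_(L^2(K)), because |v| is at
    least V / 2 on the image of the disc under the homothety of ratio 1/4 centred
    at the vertex where |v| is largest ([Lnorm_on2_affine_ge]).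

    Three facts on weak gradients carry the argument.

    The product rule ([weak_gradient_affine_product]): testing the weak gradient of
    phi with v psi gives that of v phi.  Affine functions need a genuine
    integration by parts, which is Fubini together with the fundamental theorem
    of calculus ([integral_partial1], [integral_partial2]).

    Uniqueness almost everywhere ([is_weak_gradient_ae_eq]), since the norms are
    those of some weak gradient of w, not of the one just computed.  It is the
    fundamental lemma of the calculus of variations ([du_bois_reymond]):
    indicators of open polygons are limits of the smooth functions
    prod_l exp (- 1 / (n l)), l ranging over the affine forms that define the
    polygon, and polygons generate the Borel sets.  The boundary of a triangle is
    negligible.

    The Lipschitz bound |phi x - phi y| <= M |x - y| ([weak_gradient_lipschitz]).
    In place of mollifying phi, one tests its weak gradient with a smooth plateau
    psi along the segment from x to y.  The derivative of psi in the direction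
    y - x is A - B, where A is a bump at x and B the same bump at y, so that
    int phi (A - B) is close to (phi x - phi y) int A, while integrating an affine
    coordinate against A - B bounds int psi by nearly int A
    ([transport_estimate]). *)

(** * Smooth functions of two variables *)

Definition affine (R : realType) (a b c : R) : R * R -> R :=
  fun x => a + b * x.1 + c * x.2.

(** A directional derivative only sees the restriction to a line, so it can be
    computed on a function of one real variable. *)
Lemma derive_line (R : realType) (f : R * R -> R) (F : R -> R) (x v : R * R)
    (t s : R) : (forall h : R, f (h *: v + x) = F (h *: s + t)) -> f x = F t ->
  (derivable f x v = derivable F t s) * ('D_v f x = 'D_s F t).
Proof.
move=> E E0.
have H : (fun h : R => h^-1 *: ((f \o shift x) (h *: v) - f x)) =
         (fun h : R => h^-1 *: ((F \o shift t) (h *: s) - F t)).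
  by apply/funext => h /=; rewrite E E0.
by split; rewrite /derivable /derive H.
Qed.

Lemma is_derive_scale (R : realType) (F : R -> R) (t s df : R) :
  is_derive t 1 F df -> is_derive t s F (s * df).
Proof.
move=> dF; have ? : differentiable F t by apply/derivable1_diffP; case: dF.
apply: DeriveDef; first exact: diff_derivable.
rewrite deriveE// -[s]mulr1 [LHS]linearZ /= -deriveE//.
by rewrite derive_val mulr1.
Qed.

Lemma is_derive_comp_affine (R : realType) (F : R -> R) (a b c df : R)
    (x v : R * R) : is_derive (affine a b c x) 1 F df ->
  is_derive x v (F \o affine a b c) ((b * v.1 + c * v.2) * df).
Proof.
move=> /(@is_derive_scale _ _ _ (b * v.1 + c * v.2)) [d dE].
have H : forall h : R, (F \o affine a b c) (h *: v + x) =
    F (h *: (b * v.1 + c * v.2) + affine a b c x).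
  by move=> h /=; congr F; rewrite /affine /= /GRing.scale /=; ring.
have [e1 e2] := derive_line H (erefl _).
by apply: DeriveDef; rewrite ?e1 ?e2.
Qed.

Lemma is_derive_affine (R : realType) (a b c : R) (x v : R * R) :
  is_derive x v (affine a b c) (b * v.1 + c * v.2).
Proof.
rewrite -[X in is_derive _ _ _ X]mulr1.
by have := @is_derive_comp_affine R id a b c 1 x v _; apply.
Qed.

Section Smooth.
Variable R : realType.
Implicit Types f g : R * R -> R.

Lemma CkS k f : Ck k.+1 f -> Ck k f.
Proof.
by elim: k f => [|k IH] f [] // c d /IH c1 /IH c2; split.
Qed.

Lemma Ck_cont k f : Ck k f -> continuous f.
Proof. by case: k => [//|k] []. Qed.

Lemma Ck_is_derive1 k f x : Ck k.+1 f -> is_derive x ((1, 0) : R * R) f (partial1 f x).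
Proof. by case=> _ /(_ x)[d _] _ _; apply: derivableP. Qed.

Lemma Ck_is_derive2 k f x : Ck k.+1 f -> is_derive x ((0, 1) : R * R) f (partial2 f x).
Proof. by case=> _ /(_ x)[_ d] _ _; apply: derivableP. Qed.

Lemma Ck_step k f f1 f2 : continuous f ->
  (forall x, is_derive x ((1, 0) : R * R) f (f1 x)) ->
  (forall x, is_derive x ((0, 1) : R * R) f (f2 x)) ->
  Ck k f1 -> Ck k f2 -> Ck k.+1 f.
Proof.
move=> cf d1 d2 c1 c2.
have E1 : partial1 f = f1 by apply/funext => x; rewrite /partial1; case: (d1 x).
have E2 : partial2 f = f2 by apply/funext => x; rewrite /partial2; case: (d2 x).
move: c1 c2; rewrite -E1 -E2; split => //.
Qed.

Lemma Ck_cst k (r : R) : Ck k (cst r).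
Proof.
elim: k r => [|k IH] r; first by move=> x; exact: cvg_cst.
by apply: (@Ck_step _ _ (cst 0) (cst 0)) => //= x; exact: cvg_cst.
Qed.

Lemma continuous_affine (a b c : R) : continuous (affine a b c).
Proof.
move=> x; apply: cvgD; [apply: cvgD; [exact: cvg_cst|]|].
- by apply: cvgM; [exact: cvg_cst|exact: cvg_fst].
- by apply: cvgM; [exact: cvg_cst|exact: cvg_snd].
Qed.

Lemma Ck_affine k (a b c : R) : Ck k (affine a b c).
Proof.
case: k => [|k]; first exact: continuous_affine.
apply: (@Ck_step _ _ (cst b) (cst c)); [exact: continuous_affine| | | |].
- by move=> x; apply: is_derive_eq (is_derive_affine _ _ _ _ _) _ => /=; ring.
- by move=> x; apply: is_derive_eq (is_derive_affine _ _ _ _ _) _ => /=; ring.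
- exact: Ck_cst.
- exact: Ck_cst.
Qed.

Lemma CkD k f g : Ck k f -> Ck k g -> Ck k (fun x => f x + g x).
Proof.
elim: k f g => [|k IH] f g cf cg; first by move=> x; apply: cvgD; [exact: cf|exact: cg].
have [cf0 df f1 f2] := cf; have [cg0 dg g1 g2] := cg.
apply: (@Ck_step _ _ (fun x => partial1 f x + partial1 g x)
   (fun x => partial2 f x + partial2 g x)); [ | | |exact: IH|exact: IH].
- by move=> x; apply: cvgD; [exact: cf0|exact: cg0].
- move=> x; exact: is_deriveD (Ck_is_derive1 x cf) (Ck_is_derive1 x cg).
- move=> x; exact: is_deriveD (Ck_is_derive2 x cf) (Ck_is_derive2 x cg).
Qed.

Lemma CkM k f g : Ck k f -> Ck k g -> Ck k (fun x => f x * g x).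
Proof.
elim: k f g => [|k IH] f g cf cg; first by move=> x; apply: cvgM; [exact: cf|exact: cg].
have [cf0 df f1 f2] := cf; have [cg0 dg g1 g2] := cg.
apply: (@Ck_step _ _ (fun x => f x * partial1 g x + g x * partial1 f x)
   (fun x => f x * partial2 g x + g x * partial2 f x)).
- by move=> x; apply: cvgM; [exact: cf0|exact: cg0].
- move=> x; exact: is_deriveM (Ck_is_derive1 x cf) (Ck_is_derive1 x cg).
- move=> x; exact: is_deriveM (Ck_is_derive2 x cf) (Ck_is_derive2 x cg).
- by apply: CkD; apply: IH => //; exact: CkS.
- by apply: CkD; apply: IH => //; exact: CkS.
Qed.

Lemma is_derive_inv f (x v : R * R) df : f x != 0 -> is_derive x v f df ->
  is_derive x v (fun y => (f y)^-1) (- (f x) ^- 2 * df).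
Proof.
move=> f0 [d <-]; apply: DeriveDef; first exact: derivableV.
by rewrite deriveV.
Qed.

Lemma CkV k f : (forall x, f x != 0) -> Ck k f -> Ck k (fun x => (f x)^-1).
Proof.
move=> f0; elim: k => [|k IH] cf.
  by move=> x; apply: cvgV; [exact: f0|exact: cf].
have [cf0 df f1 f2] := cf.
have E i : - (f i) ^- 2 = (-1) * ((f i)^-1 * (f i)^-1).
  by rewrite expr2 invfM mulN1r.
apply: (@Ck_step _ _ (fun x => - (f x) ^- 2 * partial1 f x)
   (fun x => - (f x) ^- 2 * partial2 f x)).
- by move=> x; apply: cvgV; [exact: f0|exact: cf0].
- move=> x; exact: is_derive_inv (f0 x) (Ck_is_derive1 x cf).
- move=> x; exact: is_derive_inv (f0 x) (Ck_is_derive2 x cf).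
- apply: CkM => //; under [X in Ck _ X]funext do rewrite E.
  by apply: CkM; [exact: Ck_cst|apply: CkM; apply: IH; exact: CkS].
- apply: CkM => //; under [X in Ck _ X]funext do rewrite E.
  by apply: CkM; [exact: Ck_cst|apply: CkM; apply: IH; exact: CkS].
Qed.

End Smooth.

Section FlatFunction.
Variable R : realType.
Implicit Types t : R.

(** Up to the factor [t^-1 ^+ n] this is the classical function that vanishes to
    infinite order at 0.  The factor makes the family closed under derivation up to
    linear combinations, so that smoothness is an induction. *)
Definition flat (n : nat) (t : R) : R :=
  if 0 < t then t^-1 ^+ n * expR (- t^-1) else 0.

Lemma flat_ge0 n t : 0 <= flat n t.
Proof.
rewrite /flat; case: ifP => // t0; rewrite mulr_ge0 ?expR_ge0//.
by rewrite exprn_ge0// invr_ge0 ltW.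
Qed.

Lemma flat_gt0 n t : 0 < t -> 0 < flat n t.
Proof. by move=> t0; rewrite /flat t0 mulr_gt0 ?expR_gt0// exprn_gt0// invr_gt0. Qed.

Lemma flat_eq0 n t : t <= 0 -> flat n t = 0.
Proof. by move=> t0; rewrite /flat ltNge t0. Qed.

Lemma flat0_le1 t : flat 0 t <= 1.
Proof.
rewrite /flat; case: ifP => // t0; rewrite expr0 mul1r.
by rewrite expR_le1 oppr_le0 invr_ge0 ltW.
Qed.

(** Exponentials beat powers; this gives the derivative 0 at the origin. *)
Lemma flat_quadratic n t : `|flat n t| <= n.+2`!%:R * t ^+ 2.
Proof.
have [t0|t0] := leP t 0.
  by rewrite flat_eq0// normr0 mulr_ge0// sqr_ge0.
rewrite ger0_norm ?flat_ge0// /flat t0.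
have s0 : 0 <= t^-1 by rewrite invr_ge0 ltW.
have := @expR_ge1Dxn R t^-1 n.+1 s0.
have := expR_gt0 t^-1; rewrite expRN; set e := expR _ => e0 He.
have {}He : t^-1 ^+ n.+2 <= n.+2`!%:R * e.
  rewrite mulrC -ler_pdivrMr ?ltr0n ?fact_gt0//.
  by apply: le_trans He; rewrite lerDr.
rewrite ler_pdivrMr//.
have -> : t^-1 ^+ n = t^-1 ^+ n.+2 * t ^+ 2.
  by rewrite -addn2 exprD -mulrA -exprMn mulVf ?gt_eqF// expr1n mulr1.
by rewrite [leRHS]mulrAC ler_wpM2r// sqr_ge0.
Qed.

Lemma is_derive_flat n t :
  is_derive t 1 (flat n) (flat n.+2 t - n%:R * flat n.+1 t).
Proof.
have [t0|t0|->] := ltgtP t 0.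
- rewrite !flat_eq0 ?(ltW t0)//.
  apply: (@near_eq_is_derive _ _ _ (cst 0)).
    by near=> u; rewrite flat_eq0//; apply/ltW; near: u; exact: lt_nbhsl.
  by rewrite mulr0 subr0; exact: is_derive_cst.
- have tn0 : t != 0 by rewrite gt_eqF.
  apply: (@near_eq_is_derive _ _ _ (fun u : R => u^-1 ^+ n * expR (- u^-1))).
    near=> u; rewrite /flat ifT//; near: u; exact: lt_nbhsr.
  have dV : is_derive t 1 (fun u : R => u^-1) (- t ^- 2).
    apply: is_derive_eq (is_deriveV tn0 (is_derive_id _ _)) _.
    by rewrite /GRing.scale /= mulr1.
  have dE : is_derive t 1 (expR \o (fun u : R => - u^-1)) (t ^- 2 * expR (- t^-1)).
    apply: is_derive_eq (is_derive1_comp _ (is_deriveN dV)) _.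
    by rewrite opprK mulrC.
  have dX : is_derive t 1 (fun u : R => u^-1 ^+ n) (- (n%:R * t^-1 ^+ n.+1)).
    have := is_deriveX n dV.
    rewrite (_ : (fun u : R => u^-1) ^+ n = (fun u : R => u^-1 ^+ n)); last first.
      by apply/funext => u; rewrite exprfctE.
    case: n => [|n] dX.
      by rewrite mul0r oppr0; under [X in is_derive _ _ X]funext do rewrite expr0;
         exact: is_derive_cst.
    apply: is_derive_eq dX _.
    rewrite /GRing.scale /= -mulr_natl -exprVn !exprS; ring.
  apply: is_derive_eq (is_deriveM dX dE) _.
  rewrite /flat t0 /GRing.scale /= -exprVn !exprS; ring.
- rewrite !flat_eq0// mulr0 subr0.
  have cv0 : (fun h : R => n.+2`!%:R * `|h|) @ 0^' --> (0 : R).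
    rewrite -[X in _ --> X](mulr0 (n.+2`!%:R)).
    apply: cvgM; first exact: cvg_cst.
    have : (fun h : R => h) @ 0^' --> (0 : R).
      by apply: (@cvg_within_filter _ _ id (nbhs (0 : R))); exact: cvg_id.
    by move/cvg_norm; rewrite normr0.
  have cv : (fun h : R => h^-1 *: ((flat n \o shift 0) (h *: 1) - flat n 0)) @ 0^' --> (0 : R).
    apply: (@squeeze_cvgr _ _ _ _ (fun h : R => - (n.+2`!%:R * `|h|))
       (fun h => n.+2`!%:R * `|h|)).
    + near=> h; have h0 : h != 0 by near: h; exact: nbhs_dnbhs_neq.
      rewrite -ler_norml /= addr0 [flat n 0]flat_eq0// subr0 [h *: 1]mulr1.
      rewrite /GRing.scale /= normrM normfV mulrC ler_pdivrMr ?normr_gt0//.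
      by rewrite -mulrA -normrM -expr2 [X in _ * X]ger0_norm ?sqr_ge0// flat_quadratic.
    + by have := cvgN cv0; rewrite oppr0; apply.
    + exact: cv0.
  apply: DeriveDef; first by apply/cvg_ex; exists 0.
  exact: cvg_lim cv.
Unshelve. all: by end_near. Qed.

Lemma continuous_flat n : continuous (flat n).
Proof.
move=> t; apply: differentiable_continuous; apply/derivable1_diffP.
by case: (is_derive_flat n t).
Qed.

Lemma Ck_flat k n (a b c : R) : Ck k (flat n \o affine a b c).
Proof.
elim: k n => [|k IH] n.
  move=> x; apply: continuous_comp; first exact: continuous_affine.
  exact: continuous_flat.
pose d (r : R) := fun x => r * ((flat n.+2 \o affine a b c) x +
   (- n%:R) * (flat n.+1 \o affine a b c) x).
have cd r : Ck k (d r).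
  apply: CkM; first exact: Ck_cst.
  by apply: CkD => //; apply: CkM => //; exact: Ck_cst.
apply: (@Ck_step _ _ _ (d b) (d c)) => //.
- move=> x; apply: continuous_comp; first exact: continuous_affine.
  exact: continuous_flat.
- move=> x; apply: is_derive_eq (is_derive_comp_affine _ (is_derive_flat n _)) _.
  by rewrite /d /=; ring.
- move=> x; apply: is_derive_eq (is_derive_comp_affine _ (is_derive_flat n _)) _.
  by rewrite /d /=; ring.
Qed.

End FlatFunction.

(** * Test functions and the plane measure *)

Section PlaneMeasure.
Variable R : realType.
Notation T2 := (measurableTypeR R * measurableTypeR R)%type.
Implicit Types (f : R * R -> R) (D : set (R * R)).

(** The sigma-algebra is the product of the Borel ones; it contains the open sets
    because the plane is second countable. *)
Lemma open_measurable2 (U : set (R * R)) : open U -> measurable (U : set T2).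
Proof.
move=> oU.
pose box (q : rat * rat * rat) : set (R * R) :=
  ball (ratr q.1.1 : R) (ratr q.2) `*` ball (ratr q.1.2 : R) (ratr q.2).
have mbox q : measurable (box q : set T2).
  by apply: measurableX; exact: measurable_ball.
suff -> : U = \bigcup_q (if `[< box q `<=` U >] then box q else set0).
  apply: countable_bigcupT_measurable => // q.
  by case: ifPn => // _; exact: mbox.
apply/seteqP; split => [x Ux|x [q _]]; last first.
  by case: ifPn => // /asboolP; apply.
have /nbhs_ballP[e /= e0 eU] : nbhs x U by exact: open_nbhs_nbhs.
(* the box of rational centre and radius k < e / 2 fits in the ball of radius e *)
have [k] := @rat_in_itvoo R 0 (e / 2) ltac:(by rewrite divr_gt0).
rewrite in_itv /= => /andP[k0 ke].
have [q1] := @rat_in_itvoo R (x.1 - ratr k) (x.1 + ratr k) ltac:(lra).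
rewrite in_itv /= => /andP[a1 b1].
have [q2] := @rat_in_itvoo R (x.2 - ratr k) (x.2 + ratr k) ltac:(lra).
rewrite in_itv /= => /andP[a2 b2].
exists (q1, q2, k) => //; rewrite ifT.
  by split; rewrite /box /= /ball /= ltr_norml; apply/andP; split; lra.
apply/asboolP => y [] /=; rewrite /ball /= !ltr_norml => /andP[c1 d1] /andP[c2 d2].
by apply: eU; split; rewrite /ball /= ltr_norml; apply/andP; split; lra.
Qed.

Lemma closed_measurable2 (U : set (R * R)) : closed U -> measurable (U : set T2).
Proof. by move/closed_openC/open_measurable2/measurableC; rewrite setCK. Qed.

Lemma compact_measurable2 (U : set (R * R)) : compact U -> measurable (U : set T2).
Proof.
by move=> cU; apply: closed_measurable2; exact: compact_closed.
Qed.

Lemma continuous_measurable2 f D : measurable (D : set T2) -> continuous f ->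
  measurable_fun (D : set T2) f.
Proof.
move=> mD cf; apply: (@measurable_funS _ _ _ _ setT) => //.
apply: (measurability _ (RGenOpens.measurableE R)).
move=> _ [_ [a [b ->] <-]]; rewrite setTI; apply: open_measurable2.
by apply: open_comp; [move=> ? _; exact: cf|exact: interval_open].
Qed.

End PlaneMeasure.

Section TestFunctions.
Variable R : realType.
Notation T2 := (measurableTypeR R * measurableTypeR R)%type.
Notation mu := (@lebesgue2 R).
Implicit Types (f g psi : R * R -> R) (D : set (R * R)).

Definition supp psi := closure [set x | psi x != 0].

Lemma notin_supp psi x : ~ supp psi x -> psi x = 0.
Proof.
move=> h; apply/eqP; apply: contra_notT h => px; exact: subset_closure.
Qed.

Lemma near_notin_supp psi x : ~ supp psi x -> \forall y \near x, ~ supp psi y.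
Proof.
by move=> h; apply: open_nbhs_nbhs; split => //; apply: closed_openC; exact: closed_closure.
Qed.

Lemma test_function_region D (S : set (R * R)) f : (forall k, Ck k f) -> closed S ->
  (forall x, ~ S x -> f x = 0) -> compact S -> S `<=` D° -> test_function D f.
Proof.
move=> cf clS f0 cS SD.
have fS : supp f `<=` S.
  rewrite [X in _ `<=` X]((closure_id _).1 clS).
  by apply: closureS => x /=; apply: contra_neqP => /f0.
split => //; last exact: subset_trans SD.
by apply: subclosed_compact cS fS; exact: closed_closure.
Qed.

Lemma test_functionS D psi g : test_function D psi -> (forall k, Ck k g) ->
  (forall x, ~ supp psi x -> g x = 0) -> test_function D g.
Proof.
move=> [_ cS SD] cg g0; apply: (test_function_region cg _ g0 cS SD).
exact: closed_closure.
Qed.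

Lemma test_functionM D psi f : test_function D psi -> (forall k, Ck k f) ->
  test_function D (fun x => f x * psi x).
Proof.
move=> tp cf; apply: (test_functionS tp).
  by move=> k; case: tp => cp _ _; exact: CkM.
by move=> x /notin_supp ->; rewrite mulr0.
Qed.

Lemma test_function_partial1 D psi : test_function D psi ->
  test_function D (partial1 psi).
Proof.
move=> tp; apply: (test_functionS tp).
  by move=> k; case: tp => /(_ k.+1) [].
move=> x /near_notin_supp h; rewrite /partial1.
rewrite (@near_eq_derive _ _ _ _ (cst 0)) ?derive_cst//.
by near=> y; apply: notin_supp; near: y.
Unshelve. all: by end_near. Qed.

Lemma test_function_partial2 D psi : test_function D psi ->
  test_function D (partial2 psi).
Proof.
move=> tp; apply: (test_functionS tp).
  by move=> k; case: tp => /(_ k.+1) [].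
move=> x /near_notin_supp h; rewrite /partial2.
rewrite (@near_eq_derive _ _ _ _ (cst 0)) ?derive_cst//.
by near=> y; apply: notin_supp; near: y.
Unshelve. all: by end_near. Qed.

Lemma test_cont D psi : test_function D psi -> continuous psi.
Proof. by case => /(_ 0). Qed.

Lemma test_supp_sub D psi : test_function D psi -> supp psi `<=` D.
Proof. by case=> _ _ h; apply: subset_trans h _; exact: interior_subset. Qed.

(** A product with psi may be integrated over any set containing the support of
    psi; this is how integrals over different domains are compared. *)
Lemma patch_supp D E f psi : supp psi `<=` D -> supp psi `<=` E ->
  (fun x => f x * psi x) \_ D = (fun x => f x * psi x) \_ E.
Proof.
move=> SD SE; apply/funext => x; rewrite !patchE.
case: (pselect (supp psi x)) => h.
  by rewrite !mem_set; [|exact: SE|exact: SD].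
by rewrite (notin_supp h) mulr0 !if_same.
Qed.

(** The integrand lives on the support of psi, a compact subset of the interior,
    on which f is integrable and psi bounded. *)
Lemma integrable_mul_test D f psi : measurable (D : set T2) ->
  locally_integrable2 D f -> test_function D psi ->
  mu.-integrable D (EFin \o (fun x => f x * psi x)).
Proof.
move=> mD [mf lf] tp; have [cp cS SD] := tp.
have mS : measurable (supp psi : set T2) by exact: compact_measurable2.
have iS : mu.-integrable (supp psi) (EFin \o (fun x => f x * psi x)).
  have -> : EFin \o (fun x => f x * psi x) = ((EFin \o f) \* (EFin \o psi))%E.
    by apply/funext => x /=; rewrite EFinM.
  apply: integrableMl => //; first exact: lf.
    by apply: continuous_measurable2 => //; exact: test_cont tp.
  have : compact (psi @` supp psi).
    by apply: continuous_compact => //; apply: continuous_subspaceT; exact: test_cont tp.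
  move/compact_bounded => [M [Mr h]]; exists M; split => // N MN x Sx.
  by apply: h => //; exists x.
apply/integrable_mkcond => //; rewrite restrict_EFin.
rewrite (@patch_supp D (supp psi)) //; last exact: test_supp_sub tp.
by rewrite -restrict_EFin; apply/(integrable_mkcond _ mS).
Qed.

End TestFunctions.

(** * Integration by parts *)

Section IntegrationByParts.
Variable R : realType.
Notation T2 := (measurableTypeR R * measurableTypeR R)%type.
Notation mu := (@lebesgue2 R).
Notation leb := (@lebesgue_measure R).
Implicit Types (f g psi : R * R -> R) (D : set (R * R)).

Lemma lebesgue2_rect (a b c d : R) : a <= b -> c <= d ->
  mu (`[a, b]%classic `*` `[c, d]%classic) = ((b - a) * (d - c))%:E.
Proof.
move=> ab cd; rewrite -[LHS]/((leb \x leb)%E _) product_measure1E//=.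
rewrite EFinM; congr (_ * _)%E; rewrite lebesgue_measure_itv /= lte_fin.
- by case: ltgtP ab => // ->; rewrite subrr.
- by case: ltgtP cd => // ->; rewrite subrr.
Qed.

Lemma integral_derivative_compact_support (F f : R -> R) (r : R) :
  0 < r -> (forall x : R, is_derive x 1 F (f x)) -> continuous f ->
  (forall x, r <= `|x| -> F x = 0 /\ f x = 0) ->
  (\int[leb]_x (f x)%:E = 0)%E.
Proof.
move=> r0 dF cf z.
have cF : continuous F.
  move=> x; apply: differentiable_continuous; apply/derivable1_diffP.
  by case: (dF x).
have -> : (\int[leb]_x (f x)%:E = \int[leb]_(x in `[(- r)%R, r]) (f x)%:E)%E.
  rewrite [RHS]integral_mkcond; apply: eq_integral => x _.
  rewrite patchE; case: ifPn => // /negP xr; rewrite (z x _).2//.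
  rewrite leNgt; apply/negP => xlt; apply: xr; rewrite inE /= in_itv /=.
  by move: xlt; rewrite ltr_norml => /andP[/ltW -> /ltW ->].
rewrite (@continuous_FTC2 _ f F); [|lra| | |].
- rewrite !(z _ _).1 ?subee// ?normrN ger0_norm//; exact: ltW.
- exact: continuous_subspaceT.
- split; first by move=> x _; case: (dF x).
  + by apply: cvg_at_right_filter; exact: cF.
  + by apply: cvg_at_left_filter; exact: cF.
- by move=> x _; rewrite derive1E; case: (dF x).
Qed.

Lemma supp_bounded D psi : test_function D psi ->
  exists2 r : R, 0 < r & forall x, r <= `|x| -> ~ supp psi x.
Proof.
case=> _ /compact_bounded[M [Mr h]] _; exists (`|M| + 1).
  by rewrite ltr_wpDl.
move=> x xr Sx; have := h (`|M| + 2^-1); rewrite (le_lt_trans (ler_norm _))//; last first.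
  by rewrite ltrDl invr_gt0.
by move=> /(_ isT x Sx) xl; have := le_trans xr xl; rewrite lerD2l; lra.
Qed.

Lemma integral_test_setT D psi : test_function D psi ->
  \int[mu]_(x in D) psi x = \int[mu]_x psi x.
Proof.
move=> tp; rewrite Rintegral_mkcond; congr Rintegral; apply/funext => x.
rewrite patchE; case: ifPn => // /negP xD; rewrite (@notin_supp _ psi)// => /(test_supp_sub tp) Dx.
by apply: xD; rewrite inE.
Qed.

Lemma locally_integrable_continuous D f : measurable (D : set T2) -> continuous f ->
  locally_integrable2 D f.
Proof.
move=> mD cf; split; first exact: continuous_measurable2.
move=> A cA AD; have mA : measurable (A : set T2) by exact: compact_measurable2.
apply: measurable_bounded_integrable => //.
- have [M [Mr h]] := compact_bounded cA.
  pose s := `|M| + 1.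
  have As : A `<=` `[- s, s]%classic `*` `[- s, s]%classic.
    move=> x Ax; have : `|x| <= s.
      by apply: h => //; rewrite (le_lt_trans (ler_norm _))// ltrDl.
    rewrite prod_normE /= ge_max => /andP[h1 h2].
    by split; rewrite /= in_itv /= -ler_norml.
  apply: (@le_lt_trans _ _ (mu (`[- s, s]%classic `*` `[- s, s]%classic))).
    by apply: le_measure => //; rewrite inE//; apply: measurableX; exact: measurable_itv.
  have s0 : 0 <= s by rewrite addr_ge0.
  by rewrite lebesgue2_rect ?ltry//; lra.
- exact: continuous_measurable2.
- have : compact (f @` A).
    by apply: continuous_compact => //; exact: continuous_subspaceT.
  move/compact_bounded => [M [Mr h]]; exists M; split => // N MN x Sx.
  by apply: h => //; exists x.
Qed.

Lemma integrable_test D psi : test_function D psi -> mu.-integrable setT (EFin \o psi).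
Proof.
move=> tp; have tpT : test_function setT psi.
  by case: tp => ? ? ?; split => //; rewrite interiorT.
have -> : EFin \o psi = EFin \o (fun x => cst 1 x * psi x).
  by apply/funext => x /=; rewrite mul1r.
apply: integrable_mul_test tpT => //.
by apply: locally_integrable_continuous => // x; exact: cvg_cst.
Qed.

(** Fundamental theorem of calculus on a segment beyond the support. *)
Lemma integral_line_partial1 D psi (y : R) : test_function D psi ->
  (\int[leb]_x (partial1 psi (x, y))%:E = 0)%E.
Proof.
move=> tp; have tp1 := test_function_partial1 tp.
have [r r0 hr] := supp_bounded tp; have [r1 r10 hr1] := supp_bounded tp1.
apply: (@integral_derivative_compact_support (fun x => psi (x, y)) _ (Num.max r r1)).
- by rewrite lt_max r0.
- move=> x; have [d] := Ck_is_derive1 (x, y) (let: And3 c _ _ := tp in c 1).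
  have H : forall h : R, psi (h *: (1, 0) + (x, y)) = (fun t => psi (t, y)) (h *: 1 + x).
    by move=> h; rewrite (_ : h *: _ + _ = (h *: 1 + x, h *: 0 + y))// scaler0 add0r.
  have [e1 e2] := derive_line (F := fun t => psi (t, y)) H erefl.
  by move=> dE; apply: DeriveDef; rewrite -?e1 -?e2.
- move=> x; apply: (@continuous_comp _ _ _ (fun x : R => (x, y)) (partial1 psi)); last by have H := test_cont tp1 (x := (x, y)); exact: H.
  have H : (x', y) @[x' --> x] --> (nbhs x, nbhs y).
    by apply: cvg_pair; [exact: cvg_id|exact: cvg_cst].
  exact: H.
- move=> x; rewrite ge_max => /andP[xr xr1].
  split; apply: notin_supp; [apply: hr|apply: hr1].
    by rewrite prod_normE le_max xr.
  by rewrite prod_normE le_max xr1.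
Qed.

(** Fubini, integrating first along the direction of differentiation. *)
Lemma integral_partial1 D psi : test_function D psi ->
  \int[mu]_(x in D) partial1 psi x = 0.
Proof.
move=> tp; have tp1 := test_function_partial1 tp.
rewrite (integral_test_setT tp1) /Rintegral /lebesgue2.
have it := integrable_test tp1.
rewrite -(integral21_prod_meas1 it) integral0_eq//= => y _.
exact: (integral_line_partial1 _ tp).
Qed.

Lemma integral_line_partial2 D psi (x : R) : test_function D psi ->
  (\int[leb]_y (partial2 psi (x, y))%:E = 0)%E.
Proof.
move=> tp; have tp1 := test_function_partial2 tp.
have [r r0 hr] := supp_bounded tp; have [r1 r10 hr1] := supp_bounded tp1.
apply: (@integral_derivative_compact_support (fun y => psi (x, y)) _ (Num.max r r1)).
- by rewrite lt_max r0.
- move=> y; have [d] := Ck_is_derive2 (x, y) (let: And3 c _ _ := tp in c 1).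
  have H : forall h : R, psi (h *: (0, 1) + (x, y)) = (fun t => psi (x, t)) (h *: 1 + y).
    by move=> h; rewrite (_ : h *: _ + _ = (h *: 0 + x, h *: 1 + y))// scaler0 add0r.
  have [e1 e2] := derive_line (F := fun t => psi (x, t)) H erefl.
  by move=> dE; apply: DeriveDef; rewrite -?e1 -?e2.
- move=> y; apply: (@continuous_comp _ _ _ (fun y : R => (x, y)) (partial2 psi)); last by have H := test_cont tp1 (x := (x, y)); exact: H.
  have H : (x, y') @[y' --> y] --> (nbhs x, nbhs y).
    by apply: cvg_pair; [exact: cvg_cst|exact: cvg_id].
  exact: H.
- move=> y; rewrite ge_max => /andP[xr xr1].
  split; apply: notin_supp; [apply: hr|apply: hr1].
    by rewrite prod_normE le_max xr orbT.
  by rewrite prod_normE le_max xr1 orbT.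
Qed.

Lemma integral_partial2 D psi : test_function D psi ->
  \int[mu]_(x in D) partial2 psi x = 0.
Proof.
move=> tp; have tp1 := test_function_partial2 tp.
rewrite (integral_test_setT tp1) /Rintegral /lebesgue2.
have it := integrable_test tp1.
rewrite -(integral12_prod_meas1 it) integral0_eq//= => x _.
exact: (integral_line_partial2 _ tp).
Qed.

End IntegrationByParts.

(** * The product rule for weak gradients *)

Section WeakProductRule.
Variable R : realType.
Notation T2 := (measurableTypeR R * measurableTypeR R)%type.
Notation mu := (@lebesgue2 R).
Implicit Types (f g psi : R * R -> R) (D : set (R * R)).

Lemma locally_integrable2D D f g : locally_integrable2 D f ->
  locally_integrable2 D g -> locally_integrable2 D (fun x => f x + g x).
Proof.
move=> [mf lf] [mg lg]; split; first exact: measurable_funD.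
move=> A cA AD; have mA : measurable (A : set T2) by exact: compact_measurable2.
by have := integrableD mA (lf _ cA AD) (lg _ cA AD).
Qed.

Lemma locally_integrable2M D f g : measurable (D : set T2) -> continuous f ->
  locally_integrable2 D g -> locally_integrable2 D (fun x => f x * g x).
Proof.
move=> mD cf [mg lg]; split.
  by apply: measurable_funM => //; exact: continuous_measurable2.
move=> A cA AD; have mA : measurable (A : set T2) by exact: compact_measurable2.
have -> : EFin \o (fun x => f x * g x) = ((EFin \o f) \* (EFin \o g))%E.
  by apply/funext => x /=; rewrite EFinM.
apply: integrableMr => //; [exact: continuous_measurable2| |exact: lg].
have : compact (f @` A).
  by apply: continuous_compact => //; exact: continuous_subspaceT.
move/compact_bounded => [M [Mr h]]; exists M; split => // N MN x Sx.
by apply: h => //; exists x.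
Qed.

Lemma locally_integrable2N D f : locally_integrable2 D f ->
  locally_integrable2 D (fun x => - f x).
Proof.
move=> [mf lf]; split; first exact: measurable_funN.
move=> A cA AD; have mA : measurable (A : set T2) by exact: compact_measurable2.
by have := integrableN (lf _ cA AD).
Qed.

Lemma locally_integrable2B D f g : locally_integrable2 D f ->
  locally_integrable2 D g -> locally_integrable2 D (fun x => f x - g x).
Proof. by move=> lf lg; apply: locally_integrable2D => //; exact: locally_integrable2N. Qed.

Lemma eq_locally_integrable D f g : {in D, f =1 g} -> locally_integrable2 D f ->
  locally_integrable2 D g.
Proof.
move=> fg [mf lf]; split; first by apply: eq_measurable_fun mf.
move=> A cA AD; have mA : measurable (A : set T2) by exact: compact_measurable2.
apply: eq_integrable (lf _ cA AD) => // x /set_mem Ax /=.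
by rewrite fg// inE; apply: interior_subset; exact: AD.
Qed.

Lemma eq_is_weak_gradient D f g G : {in D, f =1 g} -> is_weak_gradient D f G ->
  is_weak_gradient D g G.
Proof.
move=> fg [lf l1 l2 H]; split => //; first exact: eq_locally_integrable lf.
move=> psi tp; have [<- <-] := H _ tp.
by split; apply: eq_Rintegral => x xD; rewrite fg.
Qed.

Lemma partial1_affineM D (a b c : R) psi x : test_function D psi ->
  partial1 (fun y => affine a b c y * psi y) x =
  affine a b c x * partial1 psi x + b * psi x.
Proof.
case=> /(_ 1)/(Ck_is_derive1 x) dp _ _.
have [d] := is_deriveM (is_derive_affine a b c x ((1, 0) : R * R)) dp.
by rewrite /partial1 => ->; rewrite /GRing.scale /=; ring.
Qed.

Lemma partial2_affineM D (a b c : R) psi x : test_function D psi ->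
  partial2 (fun y => affine a b c y * psi y) x =
  affine a b c x * partial2 psi x + c * psi x.
Proof.
case=> /(_ 1)/(Ck_is_derive2 x) dp _ _.
have [d] := is_deriveM (is_derive_affine a b c x ((0, 1) : R * R)) dp.
by rewrite /partial2 => ->; rewrite /GRing.scale /=; ring.
Qed.

(** The product rule in one direction of differentiation, of which only the
    values [dpsi], [dvpsi], [dqpsi] matter: [v * psi] serves as test function
    for f, and the derivative of [q * psi] has integral 0. *)
Lemma integral_affine_product D f g (h v q : R * R -> R) psi (dpsi : R * R -> R)
    (dv dq : R) (dvpsi dqpsi : R * R -> R) :
  measurable (D : set T2) -> continuous v ->
  locally_integrable2 D f -> locally_integrable2 D g ->
  test_function D psi -> test_function D dvpsi -> test_function D dqpsi ->
  (forall x, dvpsi x = v x * dpsi x + dv * psi x) ->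
  (forall x, dqpsi x = q x * dpsi x + dq * psi x) ->
  (\int[mu]_(x in D) dqpsi x) = 0 ->
  (\int[mu]_(x in D) (f x * dvpsi x)) = - (\int[mu]_(x in D) (g x * (v x * psi x))) ->
  (forall x, h x = v x * g x + dv * f x - dq) ->
  (\int[mu]_(x in D) ((v x * f x - q x) * dpsi x)) = - (\int[mu]_(x in D) (h x * psi x)).
Proof.
move=> mD cv lf lg tp tv tq Ev Eq Iq Ifv Eh.
have cc (r : R) : locally_integrable2 D (cst r).
  by apply: locally_integrable_continuous => // x; exact: cvg_cst.
have l3 : locally_integrable2 D (fun x => dv * f x - dq).
  apply: locally_integrable2B; last exact: cc.
  by apply: (@locally_integrable2M D (cst dv)) => // x; exact: cvg_cst.
have l4 : locally_integrable2 D (fun x => v x * g x) by exact: locally_integrable2M.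
have i1 := integrable_mul_test mD lf tv.
have i2 : mu.-integrable D (EFin \o dqpsi).
  have := integrable_mul_test mD (cc 1) tq.
  by under [X in mu.-integrable _ (_ \o X)]funext do rewrite /cst mul1r.
have i3 := integrable_mul_test mD l3 tp.
have i4 := integrable_mul_test mD l4 tp.
transitivity (\int[mu]_(x in D) (f x * dvpsi x - dqpsi x - (dv * f x - dq) * psi x)).
  by apply: eq_Rintegral => x _; rewrite Ev Eq; ring.
rewrite RintegralB//; last exact: (integrableB mD i1 i2).
rewrite RintegralB// Iq subr0 Ifv.
under eq_Rintegral do rewrite mulrA [g _ * _]mulrC.
rewrite -opprD -RintegralD//; congr (- _).
by apply: eq_Rintegral => x _; rewrite Eh; ring.
Qed.

Lemma weak_gradient_affine_product D f G (va vb vc qa qb qc : R) :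
  measurable (D : set T2) -> is_weak_gradient D f G ->
  is_weak_gradient D (fun x => affine va vb vc x * f x - affine qa qb qc x)
   (fun x => (affine va vb vc x * (G x).1 + vb * f x - qb,
              affine va vb vc x * (G x).2 + vc * f x - qc)).
Proof.
move=> mD [lf l1 l2 H].
have cc (r : R) : locally_integrable2 D (cst r).
  by apply: locally_integrable_continuous => // x; exact: cvg_cst.
have lr g (r s : R) : locally_integrable2 D g ->
    locally_integrable2 D (fun x => affine va vb vc x * g x + r * f x - s).
  move=> lg; apply: locally_integrable2B; last exact: cc.
  apply: locally_integrable2D; apply: locally_integrable2M => //.
    exact: continuous_affine.
  by move=> x; exact: cvg_cst.
split; [|exact: lr|exact: lr|].
  apply: locally_integrable2B.
    by apply: locally_integrable2M => //; exact: continuous_affine.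
  by apply: locally_integrable_continuous => //; exact: continuous_affine.
move=> psi tp.
have tv := test_functionM tp (fun k => @Ck_affine _ k va vb vc).
have tq := test_functionM tp (fun k => @Ck_affine _ k qa qb qc).
split.
- apply: (integral_affine_product mD (@continuous_affine _ va vb vc) lf l1 tp
    (test_function_partial1 tv) (test_function_partial1 tq)).
  + by move=> x; exact: partial1_affineM tp.
  + by move=> x; exact: partial1_affineM tp.
  + exact: integral_partial1.
  + exact: (H _ tv).1.
  + by [].
- apply: (integral_affine_product mD (@continuous_affine _ va vb vc) lf l2 tp
    (test_function_partial2 tv) (test_function_partial2 tq)).
  + by move=> x; exact: partial2_affineM tp.
  + by move=> x; exact: partial2_affineM tp.
  + exact: integral_partial2.
  + exact: (H _ tv).2.
  + by [].
Qed.

End WeakProductRule.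

(** * The fundamental lemma of the calculus of variations *)

Section Bumps.
Variable R : realType.
Implicit Types (l : R * R * R) (L : seq (R * R * R)).

(** An affine form is given by its coefficients, so that polygons can be given by
    finite lists of forms. *)
Definition lform l : R * R -> R := affine l.1.1 l.1.2 l.2.

(** Since [flat 0 (n.+1%:R * t)] tends to 1 for t > 0 and is 0 otherwise, these
    smooth functions tend boundedly to the indicator of an open polygon while
    keeping their support in the closed one. *)
Definition bump L (n : nat) (x : R * R) : R :=
  \prod_(l <- L) flat 0 (n.+1%:R * lform l x).

Definition open_region L : set (R * R) := [set x | forall l, l \in L -> 0 < lform l x].

Definition closed_region L : set (R * R) :=
  [set x | forall l, l \in L -> 0 <= lform l x].

Lemma sub_open_closed_region L : open_region L `<=` closed_region L.
Proof. by move=> x Lx l lL; exact/ltW/Lx. Qed.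

Lemma open_open_region L : open (open_region L).
Proof.
elim: L => [|l L IH].
  rewrite (_ : open_region [::] = setT); first exact: openT.
  by apply/seteqP; split.
rewrite (_ : open_region _ = [set x | 0 < lform l x] `&` open_region L).
  apply: openI => //; apply: (@open_comp _ _ (lform l) [set t | 0 < t]).
    by move=> x _; exact: continuous_affine.
  exact: open_gt.
apply/seteqP; split => [x h|x [h1 h2] l']; last first.
  by rewrite inE => /predU1P[->//|/h2].
by split => [|l' l'L]; apply: h; rewrite inE ?eqxx// l'L orbT.
Qed.

Lemma closed_closed_region L : closed (closed_region L).
Proof.
elim: L => [|l L IH].
  rewrite (_ : closed_region [::] = setT); first exact: closedT.
  by apply/seteqP; split.
rewrite (_ : closed_region _ = [set x | 0 <= lform l x] `&` closed_region L).
  apply: closedI => //; apply: (@closed_comp _ _ (lform l) [set t | 0 <= t]).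
    by move=> x _; exact: continuous_affine.
  exact: closed_ge.
apply/seteqP; split => [x h|x [h1 h2] l']; last first.
  by rewrite inE => /predU1P[->//|/h2].
by split => [|l' l'L]; apply: h; rewrite inE ?eqxx// l'L orbT.
Qed.

Lemma bump_ge0 L n x : 0 <= bump L n x.
Proof. by apply: prodr_ge0 => l _; exact: flat_ge0. Qed.

Lemma bump_le1 L n x : bump L n x <= 1.
Proof. by apply: prodr_ile1 => l _; rewrite flat_ge0 flat0_le1. Qed.

Lemma bump_eq0 L n x : ~ open_region L x -> bump L n x = 0.
Proof.
move=> h; apply/eqP; rewrite prodf_seq_eq0; apply: contra_notT h => /hasPn h l lL.
have := h _ lL; rewrite andTb; apply: contraNT; rewrite -leNgt => lx.
by rewrite flat_eq0// mulr_ge0_le0.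
Qed.

Lemma Ck_bump k L n : Ck k (bump L n).
Proof.
elim: L => [|l L IH].
  rewrite (_ : bump [::] n = cst 1); first exact: Ck_cst.
  by apply/funext => x; rewrite /bump big_nil.
have -> : bump (l :: L) n = (fun x => (flat 0 \o
    affine (n.+1%:R * l.1.1) (n.+1%:R * l.1.2) (n.+1%:R * l.2)) x * bump L n x).
  apply/funext => x; rewrite /bump big_cons; congr (flat _ _ * _).
  by rewrite /lform /affine; ring.
by apply: CkM => //; exact: Ck_flat.
Qed.

Lemma cvg_flat_scale (t : R) : 0 < t -> (fun n => flat 0 (n.+1%:R * t)) @ \oo --> (1 : R).
Proof.
move=> t0.
have -> : (fun n => flat 0 (n.+1%:R * t)) = (fun n => expR (- (@harmonic R n * t^-1))).
  by apply/funext => n; rewrite /flat mulr_gt0// expr0 mul1r invfM.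
have : (fun n => - (@harmonic R n * t^-1)) @ \oo --> (0 : R).
  rewrite -[X in _ --> X]oppr0 -(mul0r t^-1); apply: cvgN; apply: cvgM.
    exact: cvg_harmonic.
  exact: cvg_cst.
by move/(continuous_cvg _ (@continuous_expR R 0)); rewrite expR0.
Qed.

Lemma cvg_bump L x : (fun n => bump L n x) @ \oo --> (\1_(open_region L) x : R).
Proof.
rewrite indicE; have [|] := boolP (x \in open_region L); last first.
  move=> /negP xL; apply: cvg_near_cst; apply: nearW => n.
  by rewrite bump_eq0// => h; apply: xL; rewrite inE.
rewrite inE /=; elim: L => [_|l L IH h].
  rewrite (_ : (fun n => bump [::] n x) = cst 1); first exact: cvg_cst.
  by apply/funext => n; rewrite /bump big_nil.
have -> : (fun n => bump (l :: L) n x) =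
    (fun n => flat 0 (n.+1%:R * lform l x) * bump L n x).
  by apply/funext => n; rewrite /bump big_cons.
rewrite -[X in _ --> X](mulr1 (1 : R)); apply: cvgM.
  by apply: cvg_flat_scale; apply: h; rewrite inE eqxx.
by apply: IH => l' l'L; apply: h; rewrite inE l'L orbT.
Qed.

Lemma supp_bump L n : supp (bump L n) `<=` closed_region L.
Proof.
rewrite [X in _ `<=` X]((closure_id _).1 (@closed_closed_region _)).
apply: closureS => x /= ; apply: contra_neqP => h; apply: bump_eq0.
by move=> /sub_open_closed_region.
Qed.

Lemma test_bump D L n : compact (closed_region L) -> closed_region L `<=` D° ->
  test_function D (bump L n).
Proof.
apply: test_function_region (fun k => @Ck_bump k L n) (@closed_closed_region L) _.
by move=> x h; apply: bump_eq0 => /sub_open_closed_region.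
Qed.

End Bumps.

Section DuBoisReymond.
Variable R : realType.
Notation T2 := (measurableTypeR R * measurableTypeR R)%type.
Notation mu := (@lebesgue2 R).
Implicit Types (l : R * R * R) (L : seq (R * R * R)).

(** Dominated convergence along the test functions [bump L n]. *)
Lemma integral_open_region D L (H : R * R -> R) : measurable (D : set T2) ->
  locally_integrable2 D H ->
  (forall psi, test_function D psi -> (\int[mu]_(x in D) (H x * psi x)) = 0) ->
  compact (closed_region L) -> closed_region L `<=` D° ->
  (\int[mu]_(x in open_region L) (H x)%:E = 0)%E.
Proof.
move=> mD lH H0 cL LD; pose C := closed_region L.
have mC : measurable (C : set T2) by exact: compact_measurable2.
have mP : measurable (open_region L : set T2) by exact: open_measurable2 (@open_open_region _ _).
have iH : mu.-integrable C (EFin \o H) by case: lH => _; apply.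
have mH : measurable_fun C H by apply/measurable_EFinP; exact: measurable_int iH.
have b1 n x : `|bump L n x| <= 1 by rewrite ger0_norm ?bump_ge0 ?bump_le1.
have [] := @dominated_convergence _ _ _ mu _ mC
   (fun n x => (H x * bump L n x)%:E) (fun x => (H x * \1_(open_region L) x)%:E)
   (fun x => (`|H x|)%:E).
- move=> n; apply/measurable_EFinP; apply: measurable_funM => //.
  by apply: continuous_measurable2 => //; apply: Ck_cont (@Ck_bump _ 0 _ _).
- by apply/measurable_EFinP; apply: measurable_funM => //; exact: measurable_indic.
- apply: aeW => x _; apply: cvg_EFin; first exact: nearW.
  by apply: cvgM; [exact: cvg_cst|exact: cvg_bump].
- exact: integrable_norm.
- apply: aeW => x n _; rewrite lee_fin normrM.
  by rewrite -[leRHS]mulr1 ler_wpM2l.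
move=> _ _ cv.
have E n : (\int[mu]_(x in C) (H x * bump L n x)%:E = 0)%E.
  have tb := test_bump n cL LD.
  have iHb := integrable_mul_test mD lH tb.
  have := H0 _ tb; rewrite /Rintegral => I0.
  have : (\int[mu]_(x in D) (H x * bump L n x)%:E = 0)%E.
    by rewrite -[LHS]fineK ?I0//; exact: integrable_fin_num iHb.
  move=> <-; rewrite integral_mkcond [RHS]integral_mkcond.
  rewrite !(restrict_EFin (fun x => H x * bump L n x)); congr (integral _ _ (EFin \o _)).
  apply: patch_supp; first exact: supp_bump.
  by apply: subset_trans (@supp_bump _ _ _) _; apply: subset_trans LD _; exact: interior_subset.
have {}cv := cvg_unique _ cv (_ : _ --> 0%E).
have <- : (\int[mu]_(x in C) (H x * \1_(open_region L) x)%:E = 0)%E.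
  apply: cv => //; apply: cvg_near_cst; apply: nearW => n; exact: E.
rewrite [RHS]integral_mkcond [LHS]integral_mkcond; apply: eq_integral => x _.
rewrite !patchE indicE; case: ifPn => xP.
  rewrite mulr1 ifT// inE; apply: sub_open_closed_region; exact: set_mem.
by rewrite mulr0 if_same.
Qed.

(** The sets of integral 0 form a lambda-system.  The map X allows one coordinate
    to be treated at a time. *)
Lemma dynkin_integral0 d (T : measurableType d) (X : T2 -> T) (G : set (set T))
    (Q : set T2) (h : T2 -> \bar R) :
  measurable_fun setT X -> measurable Q -> mu.-integrable Q h ->
  @measurable _ T = <<s G >> -> setI_closed G ->
  (\int[mu]_(x in Q) h x = 0)%E ->
  (forall A, G A -> (\int[mu]_(x in X @^-1` A `&` Q) h x = 0)%E) ->
  forall A, measurable A -> (\int[mu]_(x in X @^-1` A `&` Q) h x = 0)%E.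
Proof.
move=> mX mQ ih GE GI hQ hG A; rewrite GE.
have mXA B : measurable B -> measurable (X @^-1` B `&` Q).
  move=> mB; apply: measurableI => //; rewrite -[X in measurable X]setTI; exact: mX.
have ihS B : measurable B -> mu.-integrable (X @^-1` B `&` Q) h.
  by move=> mB; apply: integrableS ih => //; exact: mXA.
move: A; apply: (dynkin_induction (P := fun A =>
   (\int[mu]_(x in X @^-1` A `&` Q) h x = 0)%E)) => //.
- by rewrite preimage_setT setTI.
- move=> S mS hS.
  have QE : Q = (X @^-1` S `&` Q) `|` (X @^-1` (~` S) `&` Q).
    by rewrite -setIUl -preimage_setU setUv preimage_setT setTI.
  move: hQ; rewrite {1}QE integral_setU ?hS ?add0e//.
  + exact: mXA.
  + by apply: mXA; exact: measurableC.
  + by rewrite -QE; exact: measurable_int ih.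
  + by apply/disj_setPS => x [[/= Sx _] [/= nSx _]].
- move=> F mF tF hF; rewrite preimage_bigcup setI_bigcupl.
  rewrite integral_bigcup.
  + by apply: eseries0 => i _ _; exact: hF.
  + apply/trivIsetP => i j _ _ ij; move/trivIsetP : tF => /(_ i j I I ij) Fij.
    by rewrite setIACA -preimage_setI Fij preimage_set0 set0I.
  + by move=> k; exact: mXA.
  + rewrite -setI_bigcupl -preimage_bigcup; apply: ihS.
    exact: bigcupT_measurable.
Qed.

End DuBoisReymond.

Section DuBoisReymondAE.
Variable R : realType.
Notation T2 := (measurableTypeR R * measurableTypeR R)%type.
Notation mu := (@lebesgue2 R).
Implicit Types (l : R * R * R) (L : seq (R * R * R)).

(** Cutting a polygon with a quadrant only adds forms to the list. *)
Lemma open_region_half_planes L (a c : R) :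
  [/\ open_region ((- a, 1, 0) :: L) = fst @^-1` `]a, +oo[ `&` open_region L,
      open_region ((- c, 0, 1) :: L) = snd @^-1` `]c, +oo[ `&` open_region L &
      open_region ((- a, 1, 0) :: (- c, 0, 1) :: L) =
        fst @^-1` `]a, +oo[ `&` (snd @^-1` `]c, +oo[ `&` open_region L)].
Proof.
have E l L' : open_region (l :: L') = [set x | 0 < lform l x] `&` open_region L'.
  apply/seteqP; split => [x h|x [h1 h2] l']; last first.
    by rewrite inE => /predU1P[->//|/h2].
  by split => [|l' l'L]; apply: h; rewrite inE ?eqxx// l'L orbT.
have E1 : [set x | 0 < lform (- a, 1, 0) x] = fst @^-1` `]a, +oo[.
  by apply/seteqP; split => x; rewrite /lform /affine /= in_itv /= andbT; lra.
have E2 : [set x | 0 < lform (- c, 0, 1) x] = snd @^-1` `]c, +oo[.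
  by apply/seteqP; split => x; rewrite /lform /affine /= in_itv /= andbT; lra.
by split; rewrite !E ?E1 ?E2.
Qed.

(** The integral of H vanishes on the intersections of the polygon with quadrants,
    hence with products of Borel sets (one coordinate after the other), hence with
    all Borel sets. *)
Lemma du_bois_reymond_compact D L (H : R * R -> R) : measurable (D : set T2) ->
  locally_integrable2 D H ->
  (forall psi, test_function D psi -> (\int[mu]_(x in D) (H x * psi x)) = 0) ->
  compact (closed_region L) -> closed_region L `<=` D° ->
  {ae mu, forall x, open_region L x -> H x = 0}.
Proof.
move=> mD lH H0 cL LD; pose P := open_region L.
have mP : measurable (P : set T2) by exact: open_measurable2 (@open_open_region _ _).
have iH : mu.-integrable P (EFin \o H).
  case: lH => _ /(_ _ cL LD); apply: integrableS => //.
    exact: compact_measurable2.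
  exact: sub_open_closed_region.
have IP L' : (forall x, closed_region L' x -> closed_region L x) ->
    (\int[mu]_(x in open_region L') (H x)%:E = 0)%E.
  move=> L'L; apply: (integral_open_region mD lH H0).
    by apply: subclosed_compact cL L'L; exact: closed_closed_region.
  exact: subset_trans LD.
have sub1 l : closed_region (l :: L) `<=` closed_region L.
  by move=> x h l' l'L; apply: h; rewrite inE l'L orbT.
have sub2 l l' : closed_region [:: l, l' & L] `<=` closed_region L.
  by move=> x h l'' l'L; apply: h; rewrite !inE l'L !orbT.
have GI : setI_closed (@RGenOInfty.G R).
  move=> _ _ [a ->] [b ->]; exists (Num.max a b).
  by apply/seteqP; split => x /=; rewrite !in_itv /= !andbT gt_max => /andP.
have mfst : measurable_fun (setT : set T2) (fst : T2 -> measurableTypeR R) by exact: measurable_fst.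
have msnd : measurable_fun (setT : set T2) (snd : T2 -> measurableTypeR R) by exact: measurable_snd.
have S1 c (A : set (measurableTypeR R)) : measurable A ->
    (\int[mu]_(x in fst @^-1` A `&` (snd @^-1` `]c, +oo[ `&` P)) (H x)%:E = 0)%E.
  move: A; apply: (dynkin_integral0 (h := EFin \o H) mfst _ _ (RGenOInfty.measurableE R) GI).
  - apply: measurableI => //; rewrite -[X in measurable X]setTI; apply: msnd => //.
  - apply: integrableS iH => //.
    apply: measurableI => //; rewrite -[X in measurable X]setTI; apply: msnd => //.
  - by have [_ <- _] := open_region_half_planes L 0 c; apply: IP; exact: sub1.
  - by move=> _ [a ->]; have [_ _ <-] := open_region_half_planes L a c; apply: IP; exact: sub2.
have S1T (A : set (measurableTypeR R)) : measurable A ->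
    (\int[mu]_(x in fst @^-1` A `&` P) (H x)%:E = 0)%E.
  move: A; apply: (dynkin_integral0 (h := EFin \o H) mfst mP iH (RGenOInfty.measurableE R) GI).
  - exact: IP.
  - by move=> _ [a ->]; have [<- _ _] := open_region_half_planes L a 0; apply: IP; exact: sub1.
have S2 (A B : set (measurableTypeR R)) : measurable A -> measurable B ->
    (\int[mu]_(x in snd @^-1` B `&` (fst @^-1` A `&` P)) (H x)%:E = 0)%E.
  move=> mA; have mAP : measurable (fst @^-1` A `&` P : set T2).
    by apply: measurableI => //; rewrite -[X in measurable X]setTI; exact: mfst.
  move: B; apply: (dynkin_integral0 (h := EFin \o H) msnd mAP _ (RGenOInfty.measurableE R) GI).
  - exact: integrableS iH.
  - exact: S1T.
  - by move=> _ [c ->]; rewrite setICA; exact: S1.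
have S3 (E : set T2) : measurable E -> (\int[mu]_(x in id @^-1` E `&` P) (H x)%:E = 0)%E.
  move: E; apply: (dynkin_integral0 (h := EFin \o H) _ mP iH (measurable_prod_measurableType _ _)).
  - exact: measurable_id.
  - move=> _ _ [A1 mA1 [B1 mB1 <-]] [A2 mA2 [B2 mB2 <-]].
    rewrite -setXI; exists (A1 `&` A2); first exact: measurableI.
    by exists (B1 `&` B2) => //; exact: measurableI.
  - exact: IP.
  - move=> _ [A mA [B mB <-]]; rewrite preimage_id.
    rewrite (_ : _ `&` P = snd @^-1` B `&` (fst @^-1` A `&` P)); first exact: S2.
    by rewrite setIA; congr (_ `&` _); apply/seteqP; split => x [].
have := @integral_ae_eq _ _ _ mu P mP (cst 0%E) (EFin \o H) iH (@measurable_cst _ _ _ _ _ _).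
have h : forall E : set T2, E `<=` P -> measurable E ->
    (\int[mu]_(x in E) (EFin \o H) x = \int[mu]_(x in E) cst 0 x)%E.
  by move=> E EP mE; rewrite integral0 -(S3 _ mE) preimage_id setIidl.
by move=> /(_ h); apply: filterS => x /= + Px => /(_ Px) [].
Qed.

Definition shift_lform (d : R) l := (l.1.1 - d, l.1.2, l.2).

Lemma lform_shift d l x : lform (shift_lform d l) x = lform l x - d.
Proof. by rewrite /lform /affine /=; ring. Qed.

(** Exhausts the open polygon by the polygons obtained by shifting its sides
    inwards, whose closures are compact subsets of it. *)
Lemma du_bois_reymond D L (H : R * R -> R) : measurable (D : set T2) ->
  locally_integrable2 D H ->
  (forall psi, test_function D psi -> (\int[mu]_(x in D) (H x * psi x)) = 0) ->
  compact (closed_region L) -> open_region L `<=` D ->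
  {ae mu, forall x, open_region L x -> H x = 0}.
Proof.
move=> mD lH H0 cL LD; pose Ln (n : nat) := [seq shift_lform n.+1%:R^-1 l | l <- L].
have sub n : closed_region (Ln n) `<=` open_region L.
  move=> x h l lL; have := h (shift_lform n.+1%:R^-1 l) (map_f _ lL).
  by rewrite lform_shift subr_ge0; apply: lt_le_trans; rewrite invr_gt0.
have : {ae mu, forall x (n : nat), open_region (Ln n) x -> H x = 0}.
  apply/ae_foralln => n; apply: (du_bois_reymond_compact mD lH H0).
    apply: subclosed_compact cL _; first exact: closed_closed_region.
    by apply: subset_trans (@sub_open_closed_region _ _); exact: sub.
  apply: subset_trans (sub n) _; rewrite -open_subsetE//.
  exact: open_open_region.
apply: (@filterS _ _ (ae_filter_ringOfSetsType mu)) => x hx Lx.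
have [d d0 hd] : exists2 d : R, 0 < d & forall l, l \in L -> d < lform l x.
  elim: L Lx {cL LD Ln sub hx} => [|l L IH] h; first by exists 1.
  have [|d d0 hd] := IH; first by move=> l' l'L; apply: h; rewrite inE l'L orbT.
  have l0 : 0 < lform l x by apply: h; rewrite inE eqxx.
  exists (Num.min d (lform l x / 2)); first by rewrite lt_min d0 divr_gt0.
  move=> l'; rewrite inE => /predU1P[->|/hd l'd]; rewrite gt_min ?l'd//.
  by apply/orP; right; lra.
have [n _ nd] : exists2 n : nat, True & n.+1%:R^-1 < d.
  exists (Num.trunc d^-1) => //; rewrite invf_plt ?posrE//.
  exact: truncnS_gt.
apply: (hx n) => l' /mapP[l lL ->]; rewrite lform_shift subr_gt0.
exact: lt_trans nd (hd _ lL).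
Qed.

End DuBoisReymondAE.

(** * Plane geometry *)

Section Plane.
Variable R : realType.
Notation T2 := (measurableTypeR R * measurableTypeR R)%type.
Notation mu := (@lebesgue2 R).
Notation leb := (@lebesgue_measure R).

Lemma measurable_line (a b c : R) : measurable ([set x | affine a b c x = 0] : set T2).
Proof.
apply: closed_measurable2; apply: (@closed_comp _ _ (affine a b c) [set t | t = 0]).
  by move=> x _; exact: continuous_affine.
exact: closed_eq.
Qed.

Lemma lebesgue2_line (a b c : R) : (b != 0) || (c != 0) ->
  mu [set x | affine a b c x = 0] = 0%E.
Proof.
(* a line that is not vertical has vertical sections reduced to a point *)
have [->|c0 _] := eqVneq c 0; last first.
  rewrite -[LHS]/((leb \x leb)%E _) /product_measure1.
  apply: integral0_eq => x _ /=.
  rewrite (_ : xsection _ x = [set - (a + b * x) / c]) ?lebesgue_measure_set1//.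
  apply/seteqP; split => y; rewrite /xsection /= inE /affine /=.
    by move=> h; apply: (mulIf c0); rewrite divfK//; lra.
  by move=> ->; rewrite mulrCA divff// mulr1; lra.
rewrite orbF => b0.
rewrite (_ : [set x | _] = [set - a / b] `*` setT).
  rewrite -[LHS]/((leb \x leb)%E _) product_measure1E//.
  transitivity (0 * leb setT)%E; last exact: mul0e.
  by congr (_ * _)%E; exact: lebesgue_measure_set1.
apply/seteqP; split => -[x y]; rewrite /affine /=.
  by move=> h; split => //; apply: (mulIf b0); rewrite divfK//; lra.
by move=> [-> _]; rewrite mulrCA divff// mulr1; lra.
Qed.

Lemma euclid_ge0 (x : R * R) : 0 <= euclid x.
Proof. exact: sqrtr_ge0. Qed.

Lemma sqr_euclid (x : R * R) : euclid x ^+ 2 = x.1 ^+ 2 + x.2 ^+ 2.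
Proof. by rewrite sqr_sqrtr// addr_ge0// sqr_ge0. Qed.

Lemma euclid_le (x : R * R) (r : R) : 0 <= r -> (euclid x <= r) = (x.1 ^+ 2 + x.2 ^+ 2 <= r ^+ 2).
Proof. by move=> r0; rewrite -sqr_euclid ler_sqr// nnegrE// euclid_ge0. Qed.

Lemma euclid_ge (x : R * R) (r : R) : r ^+ 2 <= x.1 ^+ 2 + x.2 ^+ 2 -> r <= euclid x.
Proof.
move=> h; have [r0|r0] := leP 0 r; last exact: le_trans (ltW r0) (euclid_ge0 _).
by rewrite -ler_sqr ?nnegrE ?euclid_ge0// sqr_euclid.
Qed.

Lemma cauchy_schwarz (x y : R * R) :
  `|x.1 * y.1 + x.2 * y.2| <= euclid x * euclid y.
Proof.
rewrite -ler_sqr ?nnegrE ?mulr_ge0 ?euclid_ge0//.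
rewrite exprMn !sqr_euclid real_normK ?num_real//.
have := sqr_ge0 (x.1 * y.2 - x.2 * y.1); nra.
Qed.

Lemma euclidD (x y : R * R) : euclid (x + y) <= euclid x + euclid y.
Proof.
rewrite -ler_sqr ?nnegrE ?addr_ge0 ?euclid_ge0// sqrrD !sqr_euclid.
by have := ler_norm _ ; move=> /(_ _ (x.1 * y.1 + x.2 * y.2));
  have := cauchy_schwarz x y; rewrite /= => h1 h2; lra.
Qed.

Lemma euclidZ (r : R) (x : R * R) : euclid (r *: x) = `|r| * euclid x.
Proof.
rewrite /euclid /= /GRing.scale /= !exprMn -mulrDr sqrtrM ?sqr_ge0//.
by rewrite sqrtr_sqr.
Qed.

Lemma euclidN (x : R * R) : euclid (- x) = euclid x.
Proof. by rewrite /euclid /= !sqrrN. Qed.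

Lemma normr1_le_euclid (x : R * R) : `|x.1| <= euclid x.
Proof. by apply: euclid_ge; rewrite real_normK ?num_real// lerDl sqr_ge0. Qed.

Lemma normr2_le_euclid (x : R * R) : `|x.2| <= euclid x.
Proof. by apply: euclid_ge; rewrite real_normK ?num_real// lerDr sqr_ge0. Qed.

Lemma closed_square_sub (p : R * R) (e : R) : 0 < e ->
  `[p.1 - e / 2, p.1 + e / 2]%classic `*` `[p.2 - e / 2, p.2 + e / 2]%classic
  `<=` ball p e.
Proof.
move=> e0 x [] /=; rewrite !in_itv /= => /andP[a1 b1] /andP[a2 b2].
by split; rewrite /ball /= ltr_norml; apply/andP; split; lra.
Qed.

Lemma integral_continuous_gt0 (D : set (R * R)) (f : R * R -> R) p :
  measurable (D : set T2) -> continuous f -> (forall x, 0 <= f x) ->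
  mu.-integrable D (EFin \o f) -> 0 < f p -> D° p ->
  0 < \int[mu]_(x in D) f x.
Proof.
move=> mD cf f0 iF fp Dp.
have /nbhs_ballP[e /= e0 he] : \forall x \near p, D x /\ f p / 2 < f x.
  apply: filterI => //; have : f p / 2 < f p by lra.
  by move=> /(cvgr_gt _ (cf p)).
set Q := `[p.1 - e / 2, p.1 + e / 2]%classic `*` `[p.2 - e / 2, p.2 + e / 2]%classic.
have Qe : Q `<=` ball p e by exact: closed_square_sub.
have mQ : measurable (Q : set T2) by apply: measurableX; exact: measurable_itv.
have QD : Q `<=` D by move=> x /Qe/he[].
have fQ : mu.-integrable Q (EFin \o f) by exact: integrableS iF.
have muQ : mu Q = (e * e)%:E.
  rewrite lebesgue2_rect; [|lra|lra].
  by congr EFin; field.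
have lo : (((f p / 2) * (e * e))%:E <= \int[mu]_(x in D) (f x)%:E)%E.
  apply: (@le_trans _ _ (\int[mu]_(x in Q) (f x)%:E)%E).
    rewrite EFinM -muQ -integral_cst//; apply: ge0_le_integral => //.
    - by move=> x _; rewrite lee_fin; lra.
    - by apply: (measurable_int mu).
    - by move=> x /Qe/he[_ /ltW].
  apply: ge0_subset_integral => //; first exact: (measurable_int mu).
  by move=> x _; rewrite lee_fin.
have ifin := integrable_fin_num mD iF.
rewrite /Rintegral -lte_fin fineK//; apply: lt_le_trans lo.
by rewrite lte_fin mulr_gt0 ?divr_gt0 ?mulr_gt0.
Qed.

End Plane.

(** * Smooth steps *)

Section Step.
Variables (R : realType) (e : R).
Hypothesis e0 : 0 < e.
Implicit Types t : R.

Let f := @flat R 0.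

Lemma step_den_gt0 t : 0 < f t + f (e - t).
Proof.
have [t0|t0] := ltP 0 t.
  by apply: ltr_wpDr; [exact: flat_ge0|exact: flat_gt0].
apply: ltr_wpDl; first exact: flat_ge0.
by apply: flat_gt0; rewrite subr_gt0 (le_lt_trans t0 e0).
Qed.

(** A smooth step from 0 to 1 on the interval from 0 to e; being an explicit
    quotient it needs no primitive of a bump. *)
Definition step t := f t / (f t + f (e - t)).

Definition dstep t :=
  (flat 2 t * f (e - t) + f t * flat 2 (e - t)) / (f t + f (e - t)) ^+ 2.

Lemma step_ge0 t : 0 <= step t.
Proof. by rewrite divr_ge0// ?flat_ge0// ltW// step_den_gt0. Qed.

Lemma step_le1 t : step t <= 1.
Proof. by rewrite ler_pdivrMr ?step_den_gt0// mul1r lerDl flat_ge0. Qed.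

Lemma step_eq0 t : t <= 0 -> step t = 0.
Proof. by move=> t0; rewrite /step /f flat_eq0// mul0r. Qed.

Lemma step_eq1 t : e <= t -> step t = 1.
Proof.
move=> et; rewrite /step [f (e - t)]flat_eq0 ?addr0; last lra.
by rewrite divff// gt_eqF// flat_gt0//; exact: lt_le_trans e0 et.
Qed.

Lemma dstep_ge0 t : 0 <= dstep t.
Proof.
by rewrite /dstep divr_ge0// ?sqr_ge0// addr_ge0// mulr_ge0// flat_ge0.
Qed.

Lemma dstep_eq0 t : t <= 0 \/ e <= t -> dstep t = 0.
Proof.
rewrite /dstep /f => -[h|h]; last first.
  by rewrite !(@flat_eq0 _ _ (e - t)) ?mulr0 ?addr0 ?mul0r//; lra.
by rewrite !(@flat_eq0 _ _ t)// !mul0r addr0 mul0r.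
Qed.

Lemma dstep_gt0 t : 0 < t < e -> 0 < dstep t.
Proof.
move=> /andP[t0 te]; rewrite divr_gt0// ?exprn_gt0 ?step_den_gt0//.
have et : 0 < e - t by lra.
by rewrite addr_gt0// mulr_gt0// flat_gt0.
Qed.

Lemma is_derive_flat0 t : is_derive t 1 f (flat 2 t).
Proof.
by apply: is_derive_eq (is_derive_flat 0 t) _; rewrite mul0r subr0.
Qed.

Lemma is_derive_flat0_rev t : is_derive t 1 (fun u => f (e - u)) (- flat 2 (e - t)).
Proof.
have d : is_derive t 1 (fun u : R => e - u) (-1).
  apply: is_derive_eq (is_deriveB (is_derive_cst e t 1) (is_derive_id t 1)) _.
  by rewrite sub0r.
apply: is_derive_eq (@is_derive1_comp _ f (fun u : R => e - u) t _ _ (is_derive_flat0 _) d) _.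
by rewrite mulrN1.
Qed.

Lemma is_derive_step t : is_derive t 1 step (dstep t).
Proof.
have dd := is_deriveD (is_derive_flat0 t) (is_derive_flat0_rev t).
have n0 : (f + (fun u => f (e - u))) t != 0 by rewrite gt_eqF// step_den_gt0.
have -> : step = f * (fun y => ((f + (fun u => f (e - u))) y)^-1) by apply/funext.
apply: is_derive_eq (is_deriveM (is_derive_flat0 t) (is_deriveV n0 dd)) _.
rewrite /dstep /GRing.scale /=.
move: n0; rewrite /= !fctE => n0.
by field.
Qed.

Lemma Ck_step_affine k a b c : Ck k (step \o affine a b c).
Proof.
have E : (fun x => f (e - affine a b c x)) = flat 0 \o affine (e - a) (- b) (- c).
  by apply/funext => x /=; congr flat; rewrite /affine; ring.
apply: (@CkM _ _ (f \o affine a b c)); first exact: Ck_flat.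
apply: (@CkV _ _ (fun x => (f \o affine a b c) x + f (e - affine a b c x))).
  by move=> x; rewrite gt_eqF// step_den_gt0.
by apply: CkD; [exact: Ck_flat|rewrite E; exact: Ck_flat].
Qed.

Lemma Ck_dstep_affine k a b c : Ck k (dstep \o affine a b c).
Proof.
have E n : (fun x => flat n (e - affine a b c x)) = flat n \o affine (e - a) (- b) (- c).
  by apply/funext => x /=; congr flat; rewrite /affine; ring.
have c1 : Ck k (fun x => (f \o affine a b c) x + f (e - affine a b c x)).
  by apply: CkD; [exact: Ck_flat|rewrite E; exact: Ck_flat].
apply: (@CkM _ _ (fun x => (flat 2 \o affine a b c) x * f (e - affine a b c x) +
   (f \o affine a b c) x * flat 2 (e - affine a b c x))).
  apply: CkD; apply: CkM; rewrite ?E; exact: Ck_flat.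
apply: (@CkV _ _ (fun x => (f (affine a b c x) + f (e - affine a b c x)) ^+ 2)).
  by move=> x; rewrite expf_neq0// gt_eqF// step_den_gt0.
by under [X in Ck _ X]funext do rewrite expr2; exact: CkM.
Qed.

(** A smooth function that is positive exactly between 0 and e. *)
Definition hat t := f t * f (e - t).

Lemma is_derive_hat t :
  is_derive t 1 hat (f t * - flat 2 (e - t) + f (e - t) * flat 2 t).
Proof. exact: is_deriveM (is_derive_flat0 t) (is_derive_flat0_rev t). Qed.

Lemma hat_ge0 t : 0 <= hat t.
Proof. by rewrite mulr_ge0// flat_ge0. Qed.

Lemma hat_gt0 t : 0 < t < e -> 0 < hat t.
Proof. by move=> /andP[t0 te]; rewrite mulr_gt0// flat_gt0//; lra. Qed.

Lemma hat_eq0 t : t <= 0 \/ e <= t -> hat t = 0.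
Proof.
by rewrite /hat /f => -[h|h]; [rewrite flat_eq0// mul0r|
  rewrite (@flat_eq0 _ _ (e - t)) ?mulr0//; lra].
Qed.

Lemma Ck_hat_affine k a b c : Ck k (hat \o affine a b c).
Proof.
have E : (fun x => f (e - affine a b c x)) = flat 0 \o affine (e - a) (- b) (- c).
  by apply/funext => x /=; congr flat; rewrite /affine; ring.
apply: (@CkM _ _ (f \o affine a b c)); first exact: Ck_flat.
by rewrite E; exact: Ck_flat.
Qed.

End Step.

(** * From a bounded weak gradient to a Lipschitz constant *)

Section LipschitzBound.
Variable R : realType.
Notation T2 := (measurableTypeR R * measurableTypeR R)%type.
Notation mu := (@lebesgue2 R).
Implicit Types (D S : set (R * R)) (f psi : R * R -> R).

Lemma integrable_cst_test D psi : measurable (D : set T2) -> test_function D psi ->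
  mu.-integrable D (EFin \o psi).
Proof. by move=> mD tp; exact: integrableS (integrable_test tp). Qed.

Lemma Rintegral_lincomb D (r s : R) f g : measurable (D : set T2) ->
  mu.-integrable D (EFin \o f) -> mu.-integrable D (EFin \o g) ->
  \int[mu]_(x in D) (r * f x + s * g x) =
  r * (\int[mu]_(x in D) f x) + s * (\int[mu]_(x in D) g x).
Proof.
move=> mD fi gi; have fi' := integrableZl mD r fi; have gi' := integrableZl mD s gi.
by rewrite RintegralD// !RintegralZl.
Qed.

Lemma integral_directional0 D psi (z : R * R) : measurable (D : set T2) ->
  test_function D psi ->
  (\int[mu]_(x in D) (z.1 * partial1 psi x + z.2 * partial2 psi x)) = 0.
Proof.
move=> mD tp.
have i1 := integrable_cst_test mD (test_function_partial1 tp).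
have i2 := integrable_cst_test mD (test_function_partial2 tp).
transitivity (z.1 * 0 + z.2 * 0 : R); last by rewrite !mulr0 addr0.
rewrite (Rintegral_lincomb _ _ mD i1 i2); congr (_ * _ + _ * _).
  exact: integral_partial1 tp.
exact: integral_partial2 tp.
Qed.

Lemma weak_gradient_directional D f G psi (z : R * R) : measurable (D : set T2) ->
  is_weak_gradient D f G -> test_function D psi ->
  \int[mu]_(x in D) (f x * (z.1 * partial1 psi x + z.2 * partial2 psi x)) =
  - \int[mu]_(x in D) ((z.1 * (G x).1 + z.2 * (G x).2) * psi x).
Proof.
move=> mD [lf l1 l2 H] tp; have [H1 H2] := H _ tp.
have i1 := integrable_mul_test mD lf (test_function_partial1 tp).
have i2 := integrable_mul_test mD lf (test_function_partial2 tp).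
have j1 := integrable_mul_test mD l1 tp.
have j2 := integrable_mul_test mD l2 tp.
transitivity (z.1 * (\int[mu]_(x in D) (f x * partial1 psi x)) +
              z.2 * (\int[mu]_(x in D) (f x * partial2 psi x))).
  by rewrite -Rintegral_lincomb//; apply: eq_Rintegral => x _; ring.
rewrite H1 H2 !mulrN -opprD -Rintegral_lincomb//; congr (- _).
by apply: eq_Rintegral => x _; ring.
Qed.

(** Where g does not vanish f is within s of r, so f acts as the constant r up
    to s. *)
Lemma integral_concentrated_le D f g (r s : R) : measurable (D : set T2) ->
  mu.-integrable D (EFin \o g) -> mu.-integrable D (EFin \o (fun x => f x * g x)) ->
  (forall x, 0 <= g x) -> (forall x, D x -> g x != 0 -> `|f x - r| <= s) ->
  `|(\int[mu]_(x in D) (f x * g x)) - r * (\int[mu]_(x in D) g x)| <=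
  s * (\int[mu]_(x in D) g x).
Proof.
move=> mD gi fgi g0 h.
have gir t : mu.-integrable D (EFin \o (fun x => t * g x)) by have := integrableZl mD t gi.
have hx x : D x -> (r - s) * g x <= f x * g x <= (r + s) * g x.
  move=> Dx; have [->|gx] := eqVneq (g x) 0; first by rewrite !mulr0 lexx.
  have := h x Dx gx; rewrite ler_norml => /andP[a b].
  by rewrite !ler_wpM2r//; lra.
have lo : (r - s) * (\int[mu]_(x in D) g x) <= \int[mu]_(x in D) (f x * g x).
  rewrite -RintegralZl//; apply: le_Rintegral => //.
  by move=> x /hx/andP[].
have up : \int[mu]_(x in D) (f x * g x) <= (r + s) * (\int[mu]_(x in D) g x).
  rewrite -RintegralZl//; apply: le_Rintegral => //.
  by move=> x /hx/andP[].
by rewrite ler_norml; apply/andP; split; lra.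
Qed.

Lemma integral_ae_bound_le D (f g : R * R -> R) (M : R) : measurable (D : set T2) ->
  mu.-integrable D (EFin \o g) -> mu.-integrable D (EFin \o (fun x => f x * g x)) ->
  (forall x, 0 <= g x) -> 0 <= M -> {ae mu, forall x, D x -> `|f x| <= M} ->
  `|\int[mu]_(x in D) (f x * g x)| <= M * (\int[mu]_(x in D) g x).
Proof.
move=> mD gi fgi g0 M0 h.
have gir t : mu.-integrable D (EFin \o (fun x => t * g x)) by have := integrableZl mD t gi.
apply: (le_trans (le_normr_Rintegral mD fgi)).
rewrite -RintegralZl//.
have ni : mu.-integrable D (EFin \o (fun x => `|f x * g x|)) by exact: integrable_norm.
rewrite /Rintegral fine_le//; [exact: integrable_fin_num ni|exact: integrable_fin_num (gir M)|].
apply: ae_ge0_le_integral => //.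
- exact: measurable_int ni.
- by move=> x _; rewrite lee_fin mulr_ge0.
- exact: measurable_int (gir M).
- move: h; apply: (@filterS _ _ (ae_filter_ringOfSetsType mu)) => x hx Dx.
  by rewrite lee_fin normrM (ger0_norm (g0 x)) ler_wpM2r// hx.
Qed.

(** The bump A sits near x, the bump B near y, and [A - B] is the derivative of psi
    in the direction z.  The affine function with coefficients [a0], [a1], [a2] grows
    at unit rate along z; it is at least 0 on the support of A and at most [len] on
    that of B. *)
Section Transport.
Variables (D : set (R * R)) (f : R * R -> R) (G : R * R -> R * R).
Hypothesis mD : measurable (D : set T2).
Hypothesis fG : is_weak_gradient D f G.
Variables (Lip M : R).
Hypothesis Lip0 : 0 <= Lip.
Hypothesis f_lip : forall x y, D x -> D y -> `|f x - f y| <= Lip * `|x - y|.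
Hypothesis M0 : 0 <= M.
Hypothesis GM : {ae mu, forall x, D x -> euclid (G x) <= M}.
Variables (x y z : R * R) (a0 a1 a2 len rad : R) (A B psi : R * R -> R).
Hypothesis Dx : D x.
Hypothesis Dy : D y.
Hypothesis tA : test_function D A.
Hypothesis tB : test_function D B.
Hypothesis tpsi : test_function D psi.
Hypothesis A_ge0 : forall p, 0 <= A p.
Hypothesis B_ge0 : forall p, 0 <= B p.
Hypothesis psi_ge0 : forall p, 0 <= psi p.
Hypothesis I_gt0 : 0 < \int[mu]_(p in D) A p.
Hypothesis A_supp : forall p, A p != 0 -> 0 <= affine a0 a1 a2 p /\ `|p - x| <= rad.
Hypothesis B_supp : forall p, B p != 0 -> affine a0 a1 a2 p <= len /\ `|p - y| <= rad.
Hypothesis directional_psi : forall p,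
  z.1 * partial1 psi p + z.2 * partial2 psi p = A p - B p.
Hypothesis along_z : a1 * z.1 + a2 * z.2 = 1.

Let a := affine a0 a1 a2.
Let I := \int[mu]_(p in D) A p.

Let directional_along_psi p :
  z.1 * partial1 (fun q => a q * psi q) p + z.2 * partial2 (fun q => a q * psi q) p =
  a p * (A p - B p) + psi p.
Proof.
rewrite (partial1_affineM _ _ _ _ tpsi) (partial2_affineM _ _ _ _ tpsi) -/a.
by rewrite -directional_psi -[in RHS](mul1r (psi p)) -along_z; ring.
Qed.

Let int_A_eq_B : \int[mu]_(p in D) A p = \int[mu]_(p in D) B p.
Proof.
apply/eqP; rewrite -subr_eq0 -RintegralB//; [|exact: integrable_cst_test..].
under eq_Rintegral do rewrite -directional_psi.
by apply/eqP; exact: integral_directional0.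
Qed.

(** Integration by parts turns the integral of psi into the first moment of
    [B - A] along z. *)
Let int_psi_le : \int[mu]_(p in D) psi p <= len * I.
Proof.
have ca : continuous a by exact: continuous_affine.
have la : locally_integrable2 D a by exact: locally_integrable_continuous.
have tap := test_functionM tpsi (fun k => @Ck_affine _ k a0 a1 a2).
have iaA := integrable_mul_test mD la tA.
have iaB := integrable_mul_test mD la tB.
have E : \int[mu]_(p in D) psi p =
    (\int[mu]_(p in D) (a p * B p)) - (\int[mu]_(p in D) (a p * A p)).
  have : \int[mu]_(p in D) (z.1 * partial1 (fun q => a q * psi q) p +
      z.2 * partial2 (fun q => a q * psi q) p) = 0.
    exact: integral_directional0 tap.
  under eq_Rintegral do rewrite directional_along_psi mulrBr.
  rewrite RintegralD//; [|by have := integrableB mD iaA iaB|exact: integrable_cst_test].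
  by rewrite RintegralB//; lra.
have h1 : \int[mu]_(p in D) (a p * B p) <= len * I.
  rewrite /I int_A_eq_B -RintegralZl//; last exact: integrable_cst_test.
  apply: le_Rintegral => //.
    by have := integrableZl mD len (integrable_cst_test mD tB).
  move=> p _; have [->|/B_supp[u _]] := eqVneq (B p) 0; first by rewrite !mulr0.
  exact: ler_wpM2r.
have h2 : 0 <= \int[mu]_(p in D) (a p * A p).
  apply: Rintegral_ge0 => p _.
  have [->|/A_supp[u _]] := eqVneq (A p) 0; first by rewrite mulr0.
  exact: mulr_ge0.
by rewrite E; lra.
Qed.

(** Testing the weak gradient with psi bounds the integral of [f * (A - B)] by
    [M * euclid z] times that of psi, and f is nearly constant on the supports of A
    and B. *)
Lemma transport_estimate : `|f x - f y| <= M * euclid z * len + 2 * Lip * rad.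
Proof.
have [lf l1 l2 _] := fG.
have W := weak_gradient_directional z mD fG tpsi.
have ifA := integrable_mul_test mD lf tA.
have ifB := integrable_mul_test mD lf tB.
have iA := integrable_cst_test mD tA.
have iB := integrable_cst_test mD tB.
have ipsi := integrable_cst_test mD tpsi.
set s := Lip * rad.
have hA : `|(\int[mu]_(p in D) (f p * A p)) - f x * I| <= s * I.
  apply: integral_concentrated_le => // p Dp /A_supp[_ h].
  by apply: (le_trans (f_lip Dp Dx)); rewrite ler_wpM2l.
have hB : `|(\int[mu]_(p in D) (f p * B p)) - f y * I| <= s * I.
  rewrite /I int_A_eq_B.
  apply: integral_concentrated_le => // p Dp /B_supp[_ h].
  by apply: (le_trans (f_lip Dp Dy)); rewrite ler_wpM2l.
have lG : locally_integrable2 D (fun p => z.1 * (G p).1 + z.2 * (G p).2).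
  have m1 : locally_integrable2 D (fun p => z.1 * (G p).1).
    by apply: (@locally_integrable2M _ _ (cst z.1)) => // ?; exact: cvg_cst.
  have m2 : locally_integrable2 D (fun p => z.2 * (G p).2).
    by apply: (@locally_integrable2M _ _ (cst z.2)) => // ?; exact: cvg_cst.
  exact: locally_integrable2D m1 m2.
have hG : `|\int[mu]_(p in D) ((z.1 * (G p).1 + z.2 * (G p).2) * psi p)| <=
    M * euclid z * (\int[mu]_(p in D) psi p).
  apply: integral_ae_bound_le => //; first exact: integrable_mul_test.
    by rewrite mulr_ge0// euclid_ge0.
  apply: (@filterS _ _ (ae_filter_ringOfSetsType mu) _ _ _ GM) => p hp Dp; apply: (le_trans (cauchy_schwarz z (G p))).
  by rewrite mulrC ler_wpM2r ?euclid_ge0// hp.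
move: W; under eq_Rintegral do rewrite directional_psi mulrBr.
rewrite RintegralB// => W.
have := ler_wpM2l (mulr_ge0 M0 (euclid_ge0 z)) int_psi_le => hpsi.
suff : `|f x - f y| * I <= (M * euclid z * len + 2 * Lip * rad) * I.
  by rewrite ler_pM2r.
have I0 : 0 <= I := ltW I_gt0.
rewrite -{1}(ger0_norm I0) -normrM.
have -> : (f x - f y) * I =
  - ((\int[mu]_(p in D) (f p * A p)) - f x * I) +
  ((\int[mu]_(p in D) (f p * B p)) - f y * I) +
  ((\int[mu]_(p in D) (f p * A p)) - (\int[mu]_(p in D) (f p * B p))) by ring.
rewrite W.
apply: (le_trans (ler_normD _ _)); apply: (le_trans (lerD (ler_normD _ _) (lexx _))).
rewrite !normrN; have := le_trans hG hpsi; move: hA hB; rewrite /s; lra.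
Qed.

End Transport.

Section Strip.
Variables (D : set (R * R)) (f : R * R -> R) (G : R * R -> R * R).
Hypothesis mD : measurable (D : set T2).
Hypothesis fG : is_weak_gradient D f G.
Variables (Lip M : R).
Hypothesis Lip0 : 0 <= Lip.
Hypothesis f_lip : forall x y, D x -> D y -> `|f x - f y| <= Lip * `|x - y|.
Hypothesis M0 : 0 <= M.
Hypothesis GM : {ae mu, forall x, D x -> euclid (G x) <= M}.
Variables (x y z : R * R) (N e : R).
Hypothesis e0 : 0 < e.
Hypothesis e1 : e <= 1.
Hypothesis xy : x != y.

Hypothesis zE : z = y - x.
Hypothesis NE : N = z.1 ^+ 2 + z.2 ^+ 2.

Let N0 : 0 < N.
Proof.
rewrite NE lt_neqAle addr_ge0 ?sqr_ge0// andbT eq_sym paddr_eq0 ?sqr_ge0//.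
rewrite !sqrf_eq0 zE /= !subr_eq0; apply: contra xy => /andP[/eqP a /eqP b].
by case: x y a b => ? ? [? ?] /= -> ->.
Qed.

(** Orthogonal coordinates adapted to the segment from x to y: [along] is 0 at x
    and 1 at y, [across] is the signed distance to the line; the unit is the length
    of z. *)
Definition along : R * R -> R :=
  affine (- (z.1 * x.1 + z.2 * x.2) / N) (z.1 / N) (z.2 / N).
Definition across : R * R -> R :=
  affine ((z.2 * x.1 - z.1 * x.2) / N) (- z.2 / N) (z.1 / N).

Let a := along.
Let c := across.

Definition strip : set (R * R) :=
  [set p | 0 <= a p <= 1 + e /\ 0 <= c p <= e].

Lemma coordE p : p = (x.1 + a p * z.1 - c p * z.2, x.2 + a p * z.2 + c p * z.1).
Proof.
have n0 : N != 0 by rewrite gt_eqF.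
rewrite [LHS]surjective_pairing /a /c /along /across /affine.
move: n0; rewrite NE => n0; congr (_, _).
  by field.
by field.
Qed.

Lemma coord_dist p (s : R) (q : R * R) : q = (x.1 + s * z.1, x.2 + s * z.2) ->
  0 <= a p - s <= e -> 0 <= c p <= e -> `|p - q| <= e * (`|z.1| + `|z.2|).
Proof.
move=> -> /andP[a0 a1] /andP[c0 c1].
rewrite {1}(coordE p) prod_normE /= ge_max; apply/andP; split.
  have -> : x.1 + a p * z.1 - c p * z.2 - (x.1 + s * z.1) =
    (a p - s) * z.1 - c p * z.2 by ring.
  apply: (le_trans (ler_normB _ _)); rewrite mulrDr !normrM (ger0_norm a0) (ger0_norm c0).
  by apply: lerD; rewrite ler_wpM2r.
have -> : x.2 + a p * z.2 + c p * z.1 - (x.2 + s * z.2) =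
  c p * z.1 + (a p - s) * z.2 by ring.
apply: (le_trans (ler_normD _ _)); rewrite mulrDr !normrM (ger0_norm a0) (ger0_norm c0).
by apply: lerD; rewrite ler_wpM2r.
Qed.

Hypothesis strip_compact : compact strip.
Hypothesis strip_sub : strip `<=` D°.
Hypothesis Dx : D x.
Hypothesis Dy : D y.

Let A p := dstep e (a p) * hat e (c p).
Let B p := dstep e (a p - 1) * hat e (c p).
(** A plateau around the segment: the step entering at x minus the step leaving
    at y, cut off transversally. *)
Let psi p := (step e (a p) - step e (a p - 1)) * hat e (c p).

Let aS : (fun p => a p - 1) = affine (- (z.1 * x.1 + z.2 * x.2) / N - 1) (z.1 / N) (z.2 / N).
Proof. by apply/funext => p; rewrite /a /along /affine; ring. Qed.

Let CA k : Ck k A.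
Proof. by apply: CkM; [exact: Ck_dstep_affine|exact: Ck_hat_affine]. Qed.

Let CB k : Ck k B.
Proof.
apply: (@CkM _ _ (fun p => dstep e (a p - 1)) (fun p => hat e (c p))); last exact: Ck_hat_affine.
by have := Ck_dstep_affine e0 k (- (z.1 * x.1 + z.2 * x.2) / N - 1) (z.1 / N) (z.2 / N);
  rewrite -aS.
Qed.

Let Cpsi k : Ck k psi.
Proof.
apply: (@CkM _ _ (fun p => step e (a p) - step e (a p - 1)) (fun p => hat e (c p)));
  last exact: Ck_hat_affine.
have -> : (fun p => step e (a p) - step e (a p - 1)) =
   (fun p => step e (a p) + (-1) * step e (a p - 1)).
  by apply/funext => p; rewrite mulN1r.
apply: (@CkD _ _ (fun p => step e (a p))); first exact: Ck_step_affine.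
apply: (@CkM _ _ (cst (-1))); first exact: Ck_cst.
by have := Ck_step_affine e0 k (- (z.1 * x.1 + z.2 * x.2) / N - 1) (z.1 / N) (z.2 / N);
  rewrite -aS.
Qed.

Let hat_supp p : hat e (c p) != 0 -> 0 <= c p <= e.
Proof.
move=> h; apply/andP; split; rewrite leNgt; apply/negP => lt; move: h.
  by rewrite hat_eq0 ?eqxx//; left; exact: ltW.
by rewrite hat_eq0 ?eqxx//; right; exact: ltW.
Qed.

Let dstep_supp t : dstep e t != 0 -> 0 <= t <= e.
Proof.
move=> h; apply/andP; split; rewrite leNgt; apply/negP => lt; move: h.
  by rewrite dstep_eq0 ?eqxx//; left; exact: ltW.
by rewrite dstep_eq0 ?eqxx//; right; exact: ltW.
Qed.

Let A_supp p : A p != 0 -> 0 <= a p <= e /\ 0 <= c p <= e.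
Proof. by rewrite mulf_eq0 negb_or => /andP[/dstep_supp ? /hat_supp]. Qed.

Let B_supp p : B p != 0 -> 0 <= a p - 1 <= e /\ 0 <= c p <= e.
Proof. by rewrite mulf_eq0 negb_or => /andP[/dstep_supp ? /hat_supp]. Qed.

Let psi_supp p : psi p != 0 -> 0 <= a p <= 1 + e /\ 0 <= c p <= e.
Proof.
rewrite mulf_eq0 negb_or => /andP[h /hat_supp]; split => //.
apply/andP; split; rewrite leNgt; apply/negP => lt; move: h.
  by rewrite !(@step_eq0 _ e)// ?subrr ?eqxx//; lra.
by rewrite !(@step_eq1 _ e)// ?subrr ?eqxx//; lra.
Qed.

Let closed_strip : closed strip.
Proof. exact: compact_closed strip_compact. Qed.

Let tA : test_function D A.
Proof.
apply: (test_function_region (S := strip)) => // p; apply: contra_notP => /eqP/A_supp[/andP[h1 h2] ?].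
by split => //; rewrite h1 /=; lra.
Qed.

Let tB : test_function D B.
Proof.
apply: (test_function_region (S := strip)) => // p; apply: contra_notP => /eqP/B_supp[/andP[h1 h2] ?].
by split => //; apply/andP; split; lra.
Qed.

Let tpsi : test_function D psi.
Proof.
by apply: (test_function_region (S := strip)) => // p; apply: contra_notP => /eqP/psi_supp.
Qed.

Let psi_ge0 p : 0 <= psi p.
Proof.
have [->//|/psi_supp[/andP[a0 a1] _]] := eqVneq (psi p) 0.
rewrite mulr_ge0 ?hat_ge0// subr_ge0.
have [h|h] := leP e (a p); first by rewrite [leRHS]step_eq1// step_le1.
by rewrite step_eq0 ?step_ge0// subr_le0 (le_trans (ltW h)).
Qed.

Let A_ge0 p : 0 <= A p.
Proof. by rewrite mulr_ge0 ?hat_ge0// dstep_ge0. Qed.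

Let B_ge0 p : 0 <= B p.
Proof. by rewrite mulr_ge0 ?hat_ge0// dstep_ge0. Qed.

Let kappa p := flat 0 (c p) * - flat 2 (e - c p) + flat 0 (e - c p) * flat 2 (c p).

Let is_derive_psi p v : is_derive p v psi
  ((step e (a p) - step e (a p - 1)) * ((- z.2 / N * v.1 + z.1 / N * v.2) * kappa p) +
   (z.1 / N * v.1 + z.2 / N * v.2) * (A p - B p)).
Proof.
have d1 : is_derive p v (step e \o a) ((z.1 / N * v.1 + z.2 / N * v.2) * dstep e (a p)).
  by apply: is_derive_comp_affine; exact: is_derive_step.
have d2 : is_derive p v (step e \o (fun p => a p - 1))
    ((z.1 / N * v.1 + z.2 / N * v.2) * dstep e (a p - 1)).
  have := is_derive_comp_affine v (is_derive_step e0
    (affine (- (z.1 * x.1 + z.2 * x.2) / N - 1) (z.1 / N) (z.2 / N) p)).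
  by rewrite -aS.
have d3 := is_derive_comp_affine v (is_derive_hat e (c p)).
apply: is_derive_eq (is_deriveM (is_deriveB d1 d2) d3) _.
transitivity ((step e (a p) - step e (a p - 1)) *
     ((- z.2 / N * v.1 + z.1 / N * v.2) * kappa p) +
   hat e (c p) * ((z.1 / N * v.1 + z.2 / N * v.2) * dstep e (a p) -
     (z.1 / N * v.1 + z.2 / N * v.2) * dstep e (a p - 1))); first by [].
by rewrite /A /B; ring.
Qed.

(** The transversal factor is constant along z, so only the steps are
    differentiated. *)
Let directional_psi p : z.1 * partial1 psi p + z.2 * partial2 psi p = A p - B p.
Proof.
have n0 : N != 0 by rewrite gt_eqF.
have [_ E1] := is_derive_psi p ((1, 0) : R * R).
have [_ E2] := is_derive_psi p ((0, 1) : R * R).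
rewrite /partial1 /partial2 E1 E2 /=.
by move: n0; rewrite NE => n0; field.
Qed.

Let I_gt0 : 0 < \int[mu]_(p in D) A p.
Proof.
pose p := (x.1 + e / 2 * z.1 - e / 2 * z.2, x.2 + e / 2 * z.2 + e / 2 * z.1).
have n0 : N != 0 by rewrite gt_eqF.
have ap : a p = e / 2.
  by move: n0; rewrite /p /a /along /affine NE /= => n0; field.
have cp : c p = e / 2.
  by move: n0; rewrite /p /c /across /affine NE /= => n0; field.
have e2 : 0 < e / 2 < e by apply/andP; split; move: e0; lra.
apply: (@integral_continuous_gt0 _ D A p mD (CA 0) A_ge0).
- exact: integrable_cst_test.
- by rewrite /A ap cp; apply: mulr_gt0; [exact: dstep_gt0|exact: hat_gt0].
- by apply: strip_sub; rewrite /strip /= ap cp; split; apply/andP; split; lra.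
Qed.

Lemma strip_estimate :
  `|f x - f y| <= M * euclid z * (1 + e) + 2 * Lip * (e * (`|z.1| + `|z.2|)).
Proof.
have n0 : N != 0 by rewrite gt_eqF.
have az : z.1 / N * z.1 + z.2 / N * z.2 = 1.
  by move: n0; rewrite NE => n0; field.
apply: (transport_estimate mD fG Lip0 f_lip M0 GM Dx Dy tA tB tpsi A_ge0 B_ge0 psi_ge0
  I_gt0 _ _ directional_psi az).
- move=> p /A_supp[h1 h2]; split; first by move: h1 => /andP[h1 _]; exact: h1.
  by apply: (@coord_dist p 0); [rewrite !mul0r !addr0 -surjective_pairing|rewrite subr0|].
- move=> p /B_supp[h1 h2]; split; first by move: h1; rewrite lerBlDl => /andP[_ h1]; exact: h1.
  by apply: (@coord_dist p 1); [rewrite !mul1r zE; case: (x) (y) => ? ? [? ?] /=; congr (_, _); ring| |].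
Qed.

End Strip.
End LipschitzBound.

Section LipschitzInRegion.
Variable R : realType.
Notation T2 := (measurableTypeR R * measurableTypeR R)%type.
Notation mu := (@lebesgue2 R).
Implicit Types (l : R * R * R) (L : seq (R * R * R)).

(** An affine form positive at both ends of a segment, with values u and v, stays
    positive on a thin strip around it; k is its slope across. *)
Lemma segment_thickening (u v k : R) : 0 < u -> 0 < v ->
  exists2 d : R, 0 < d & forall e s t : R, 0 < e -> e <= d ->
    0 <= s <= 1 + e -> 0 <= t <= e -> 0 < (1 - s) * u + s * v + t * k.
Proof.
move=> u0 v0; pose m := Num.min u v.
have m0 : 0 < m by rewrite lt_min u0 v0.
have mu_ : m <= u by rewrite ge_min lexx.
have mv : m <= v by rewrite ge_min lexx orbT.
pose K := `|v - u| + `|k| + 1.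
have vu0 := normr_ge0 (v - u); have k0 := normr_ge0 k.
have K0 : 0 < K by rewrite /K; lra.
exists (m / (2 * K)); first by rewrite divr_gt0// mulr_gt0.
move=> e s t e0 ed /andP[s0 s1] /andP[t0 t1].
have eK : e * K <= m / 2.
  have -> : m / 2 = m / (2 * K) * K by field; rewrite gt_eqF.
  by rewrite ler_wpM2r// ltW.
have tk : - (e * `|k|) <= t * k.
  have : `|t * k| <= e * `|k| by rewrite normrM (ger0_norm t0) ler_wpM2r.
  by rewrite ler_norml => /andP[].
have sv : m - e * `|v - u| <= (1 - s) * u + s * v.
  have [s1'|s1'] := lerP s 1.
    have h1 : (1 - s) * m <= (1 - s) * u by rewrite ler_wpM2l// subr_ge0.
    have h2 : s * m <= s * v by rewrite ler_wpM2l.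
    have h3 : 0 <= e * `|v - u| by rewrite mulr_ge0// ltW.
    lra.
  have : `|(s - 1) * (v - u)| <= e * `|v - u|.
    have s10 : 0 <= s - 1 by rewrite subr_ge0 ltW.
    by rewrite normrM (ger0_norm s10) ler_wpM2r// lerBlDl.
  rewrite ler_norml => /andP[h _]; lra.
have eKE : e * K = e * `|v - u| + e * `|k| + e by rewrite /K; ring.
lra.
Qed.

Lemma strip_in_region L (x y z : R * R) (N : R) : open_region L x -> open_region L y ->
  z = y - x -> N = z.1 ^+ 2 + z.2 ^+ 2 -> x != y ->
  exists2 d : R, 0 < d & forall e, 0 < e -> e <= d -> strip x z N e `<=` open_region L.
Proof.
move=> + + zE NE xy; elim: L => [|l L IH] Lx Ly; first by exists 1.
have [d d0 hd] : exists2 d : R, 0 < d &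
    forall e, 0 < e -> e <= d -> strip x z N e `<=` open_region L.
  by apply: IH => l' l'L; [apply: Lx|apply: Ly]; rewrite inE l'L orbT.
have lx : 0 < lform l x by apply: Lx; rewrite inE eqxx.
have ly : 0 < lform l y by apply: Ly; rewrite inE eqxx.
have [d' d'0 hd'] := segment_thickening (- l.1.2 * z.2 + l.2 * z.1) lx ly.
exists (Num.min d d'); first by rewrite lt_min d0.
move=> e e0; rewrite le_min => /andP[ed ed'] p sp l'; rewrite inE => /predU1P[->|]; last first.
  exact: hd sp l'.
have := sp; rewrite /strip /= => -[s1 s2].
have := hd' _ _ _ e0 ed' s1 s2.
suff -> : lform l p = (1 - along x z N p) * lform l x + along x z N p * lform l y +
  across x z N p * (- l.1.2 * z.2 + l.2 * z.1) by [].
have := coordE xy zE NE p; set a := along _ _ _ _; set c := across _ _ _ _ => pE.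
rewrite pE zE /lform /affine /=; ring.
Qed.

Lemma closed_strip (x z : R * R) (N e : R) : closed (strip x z N e).
Proof.
have c1 : continuous (along x z N) by exact: continuous_affine.
have c2 : continuous (across x z N) by exact: continuous_affine.
have -> : strip x z N e = (along x z N @^-1` [set t | 0 <= t] `&`
   along x z N @^-1` [set t | t <= 1 + e]) `&` (across x z N @^-1` [set t | 0 <= t] `&`
   across x z N @^-1` [set t | t <= e]).
  apply/seteqP; split => p; rewrite /strip /=.
    by move=> [/andP[? ?] /andP[? ?]].
  by move=> [[-> ->] [-> ->]].
by apply: closedI; apply: closedI; apply: closed_comp;
  do ?[exact: closed_ge|exact: closed_le|by move=> ? _; exact: c1|by move=> ? _; exact: c2].
Qed.

(** A thin strip around the segment from x to y stays in the convex region; let its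
    width e tend to 0 in [strip_estimate].  The a priori constant [Lip] disappears in
    the limit. *)
Lemma weak_gradient_lipschitz (D : set (R * R)) L f G (Lip M : R) :
  measurable (D : set T2) -> is_weak_gradient D f G ->
  0 <= Lip -> (forall x y, D x -> D y -> `|f x - f y| <= Lip * `|x - y|) ->
  0 <= M -> {ae mu, forall x, D x -> euclid (G x) <= M} ->
  compact (closed_region L) -> open_region L `<=` D ->
  forall x y, open_region L x -> open_region L y ->
    `|f x - f y| <= M * euclid (x - y).
Proof.
move=> mD fG Lip0 fl M0 GM cL LD x y Lx Ly.
have [->|xy] := eqVneq x y; first by rewrite !subrr normr0 mulr_ge0// euclid_ge0.
pose z := y - x; pose N := z.1 ^+ 2 + z.2 ^+ 2.
have [d d0 hd] := strip_in_region Lx Ly (erefl z) (erefl N) xy.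
have -> : euclid (x - y) = euclid z by rewrite -euclidN opprB.
have LDo : open_region L `<=` D° by rewrite -open_subsetE//; exact: open_open_region.
have est e : 0 < e -> e <= 1 -> e <= d ->
    `|f x - f y| <= M * euclid z * (1 + e) + 2 * Lip * (e * (`|z.1| + `|z.2|)).
  move=> e0 e1 ed.
  apply: (strip_estimate mD fG Lip0 fl M0 GM e0 e1 xy (erefl z) (erefl N)).
  - apply: subclosed_compact cL _; first exact: closed_strip.
    by apply: subset_trans (@sub_open_closed_region _ _); exact: hd.
  - by apply: subset_trans LDo; exact: hd.
  - exact: LD.
  - exact: LD.
pose S := M * euclid z + 2 * Lip * (`|z.1| + `|z.2|) + 1.
have S0 : 0 < S.
  by rewrite /S ltr_pwDr// addr_ge0// !mulr_ge0// ?euclid_ge0// addr_ge0.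
apply/ler_addgt0Pr => t t0.
pose e := Num.min (t / S) (Num.min 1 d).
have e0 : 0 < e by rewrite !lt_min divr_gt0//= ltr01.
have et : e <= t / S by rewrite ge_min lexx.
have e1 : e <= 1 by rewrite !ge_min lexx orbT.
have ed : e <= d by rewrite !ge_min lexx !orbT.
apply: (le_trans (est e e0 e1 ed)).
have h : e * S <= t by rewrite -ler_pdivlMr.
have SE : e * S = e * (M * euclid z) + e * (2 * Lip * (`|z.1| + `|z.2|)) + e by rewrite /S; ring.
have -> : M * euclid z * (1 + e) + 2 * Lip * (e * (`|z.1| + `|z.2|)) =
  M * euclid z + (e * (M * euclid z) + e * (2 * Lip * (`|z.1| + `|z.2|))) by ring.
by rewrite lerD2l (le_trans _ h)// SE lerDl ltW.
Qed.

End LipschitzInRegion.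

(** * Geometry of a triangle *)

Section TriangleGeometry.
Variable R : realType.
Notation T2 := (measurableTypeR R * measurableTypeR R)%type.
Notation mu := (@lebesgue2 R).
Implicit Types (K : triangle R) (p q : R * R).

Lemma sum_ord3 (V : nmodType) (F : 'I_3 -> V) : \sum_i F i = F 0 + F 1 + F 2%:R.
Proof.
rewrite !big_ord_recl big_ord0 addr0 addrA.
by congr (F _ + F _ + F _); apply: val_inj.
Qed.

Lemma ord3P (P : 'I_3 -> Prop) : P 0 -> P 1 -> P 2%:R -> forall i, P i.
Proof.
move=> P0 P1 P2 [[|[|[|//]]] i3].
- by rewrite (_ : Ordinal i3 = 0)//; exact: val_inj.
- by rewrite (_ : Ordinal i3 = 1)//; exact: val_inj.
- by rewrite (_ : Ordinal i3 = 2%:R)//; exact: val_inj.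
Qed.

Definition triangle_det K : R :=
  (vertex K 1 - vertex K 0).1 * (vertex K 2%:R - vertex K 0).2 -
  (vertex K 1 - vertex K 0).2 * (vertex K 2%:R - vertex K 0).1.

Lemma triangle_det_neq0 K : triangle_det K != 0.
Proof. exact: vertex_nondegenerate. Qed.

Definition bary1 K : R * R * R :=
  let a := vertex K 0 in let w := vertex K 2%:R - a in
  (- (a.1 * w.2 - a.2 * w.1) / triangle_det K, w.2 / triangle_det K, - w.1 / triangle_det K).

Definition bary2 K : R * R * R :=
  let a := vertex K 0 in let u := vertex K 1 - a in
  (- (u.1 * a.2 - u.2 * a.1) / triangle_det K, - u.2 / triangle_det K, u.1 / triangle_det K).

(** Barycentric coordinates, as coefficient triples: the triangle becomes a polygon
    in the sense of [closed_region]. *)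
Definition bary0 K : R * R * R :=
  (1 - (bary1 K).1.1 - (bary2 K).1.1, - (bary1 K).1.2 - (bary2 K).1.2,
   - (bary1 K).2 - (bary2 K).2).

Definition bary_forms K := [:: bary0 K; bary1 K; bary2 K].

Definition bary K (i : 'I_3) := nth (bary0 K) (bary_forms K) i.

Lemma bary_sum K p : \sum_i lform (bary K i) p = 1.
Proof. by rewrite sum_ord3 /lform /affine /bary /=; ring. Qed.

Lemma bary_pointE K p : p = \sum_i lform (bary K i) p *: vertex K i.
Proof.
have nd := triangle_det_neq0 K.
rewrite sum_ord3 /lform /affine /bary /= /bary0 /bary1 /bary2 /=.
move: nd; rewrite /triangle_det /=.
case: (vertex K 0) (vertex K 1) (vertex K 2%:R) => [a1 a2] [b1 b2] [c1 c2] /= nd.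
have SE (r s : R) : r *: s = r * s by [].
by case: p => p1 p2 /=; congr (_, _); rewrite /= !SE; field.
Qed.

Lemma affine_comb (a b c : R) (t : 'I_3 -> R) (P : 'I_3 -> R * R) : \sum_i t i = 1 ->
  affine a b c (\sum_i t i *: P i) = \sum_i t i * affine a b c (P i).
Proof.
rewrite !sum_ord3 => t1; rewrite /affine /= /GRing.scale /=.
transitivity (a * (t 0 + t 1 + t 2%:R) + b * (t 0 * (P 0).1 + t 1 * (P 1).1 + t 2%:R * (P 2%:R).1)
   + c * (t 0 * (P 0).2 + t 1 * (P 1).2 + t 2%:R * (P 2%:R).2)); last by ring.
by rewrite t1 mulr1.
Qed.

Lemma bary_vertex K i j : lform (bary K i) (vertex K j) = (i == j)%:R.
Proof.
have := triangle_det_neq0 K.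
move: i j; apply: ord3P; apply: ord3P => nd;
  rewrite /bary /lform /affine /= /bary0 /bary1 /bary2 /=;
  move: nd; rewrite /triangle_det /=;
  case: (vertex K 0) (vertex K 1) (vertex K 2%:R) => [a1 a2] [b1 b2] [c1 c2] /= nd;
  by field.
Qed.

Lemma triangle_setP K p : triangle_set K p <-> forall i, 0 <= lform (bary K i) p.
Proof.
split=> [[t [t0 _ t1 ->]] i|h]; last first.
  exists (fun i => lform (bary K i) p); split => //.
  - by move=> i; rewrite inE.
  - exact: bary_sum.
  - exact: bary_pointE.
rewrite /lform affine_comb//; apply: sumr_ge0 => j _.
by rewrite -/(lform _ _) bary_vertex mulr_ge0.
Qed.

Lemma mem_bary K l : reflect (exists i, l = bary K i) (l \in bary_forms K).
Proof.
apply: (iffP idP) => [|[i ->]]; last by rewrite mem_nth.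
rewrite !inE => /or3P[/eqP ->|/eqP ->|/eqP ->].
- by exists 0.
- by exists 1.
- by exists 2%:R.
Qed.

Lemma triangle_closed_region K : triangle_set K = closed_region (bary_forms K).
Proof.
apply/seteqP; split => p.
  by move=> /triangle_setP h l /mem_bary[i ->].
by move=> h; apply/triangle_setP => i; apply: h; apply/mem_bary; exists i.
Qed.

Lemma bary_le1 K p i : triangle_set K p -> lform (bary K i) p <= 1.
Proof.
move=> /triangle_setP h; rewrite -(bary_sum K p) (bigD1 i)//= lerDl.
by apply: sumr_ge0.
Qed.

Lemma vertex_in K i : triangle_set K (vertex K i).
Proof. by apply/triangle_setP => j; rewrite bary_vertex. Qed.

Lemma triangle_bounded K : exists2 s : R, 0 < s & triangle_set K `<=` [set p | `|p| <= s].
Proof.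
exists (1 + \sum_i `|vertex K i|); first by rewrite ltr_pwDl// sumr_ge0.
move=> p Kp /=; rewrite (bary_pointE K p).
apply: (le_trans (ler_norm_sum _ _ _)); rewrite ler_wpDl//.
apply: ler_sum => i _; rewrite normrZ ler_piMl//.
by rewrite ger0_norm; [exact: bary_le1|exact: (triangle_setP K p).1].
Qed.

Lemma triangle_compact K : compact (triangle_set K).
Proof.
have [s s0 hs] := triangle_bounded K.
have cb : compact (`[- s, s]%classic `*` `[- s, s]%classic : set (R * R)).
  by apply: compact_setX; exact: segment_compact.
apply: subclosed_compact cb _.
  by rewrite triangle_closed_region; exact: closed_closed_region.
move=> p /hs /=; rewrite prod_normE /= ge_max => /andP[h1 h2].
by split; rewrite /= in_itv /= -ler_norml.
Qed.

Lemma triangle_measurable K : measurable (triangle_set K : set T2).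
Proof. exact: compact_measurable2 (@triangle_compact K). Qed.

Lemma open_triangle_sub K : open_region (bary_forms K) `<=` triangle_set K.
Proof. by rewrite triangle_closed_region; exact: sub_open_closed_region. Qed.

Lemma bary_gradient_neq0 K i : ((bary K i).1.2 != 0) || ((bary K i).2 != 0).
Proof.
rewrite -[_ || _]negbK negb_or !negbK; apply/negP => /andP[/eqP h1 /eqP h2].
pose j : 'I_3 := if i == 0 then 1 else 0.
have ij : i != j by rewrite /j; case: (eqVneq i 0) => [->|].
have := bary_vertex K i i; have := bary_vertex K i j.
rewrite /lform /affine h1 h2 !mul0r !addr0 eqxx (negbTE ij) => ->.
by move/eqP; rewrite eq_sym oner_eq0.
Qed.

Lemma ae_open_triangle K :
  {ae mu, forall p, triangle_set K p -> open_region (bary_forms K) p}.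
Proof.
have h i : {ae mu, forall p, lform (bary K i) p != 0}.
  exists [set p | lform (bary K i) p = 0]; split.
  - exact: measurable_line.
  - exact: lebesgue2_line (bary_gradient_neq0 K i).
  - by move=> p /= /negP; rewrite negbK => /eqP.
apply: (@filterS3 _ _ (ae_filter_ringOfSetsType mu) _ _ _ _ _ (h 0) (h 1) (h 2%:R)) => p h0 h1 h2 Kp.
have {}h : forall i, lform (bary K i) p != 0 by apply: ord3P.
move=> l /mem_bary[i ->]; rewrite lt_neqAle eq_sym h/=.
exact: (triangle_setP K p).1.
Qed.

Lemma affine_le_vertices K (a b c m : R) p : triangle_set K p ->
  (forall i, `|affine a b c (vertex K i)| <= m) -> `|affine a b c p| <= m.
Proof.
move=> Kp h; have := Kp => /triangle_setP t0.
rewrite {1}(bary_pointE K p) affine_comb ?bary_sum//.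
apply: (le_trans (ler_norm_sum _ _ _)).
rewrite -[leRHS]mul1r -(bary_sum K p) mulr_suml; apply: ler_sum => i _.
by rewrite normrM ger0_norm// ler_wpM2l.
Qed.

Lemma triangle_convex K p q (t : R) : triangle_set K p -> triangle_set K q ->
  0 <= t <= 1 -> triangle_set K ((1 - t) *: p + t *: q).
Proof.
move=> /triangle_setP hp /triangle_setP hq /andP[t0 t1]; apply/triangle_setP => i.
have -> : lform (bary K i) ((1 - t) *: p + t *: q) =
   (1 - t) * lform (bary K i) p + t * lform (bary K i) q.
  by rewrite /lform /affine /= /GRing.scale /=; ring.
by rewrite addr_ge0// mulr_ge0// subr_ge0.
Qed.

Lemma diam_ub K p q : triangle_set K p -> triangle_set K q ->
  euclid (p - q) <= diam (triangle_set K).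
Proof.
move=> Kp Kq; apply: ub_le_sup; last by exists p, q.
have [s s0 hs] := triangle_bounded K.
exists (4 * s) => _ [p' [q' [/hs/= hp /hs/= hq ->]]].
move: hp hq; rewrite !prod_normE /= !ge_max => /andP[a1 a2] /andP[b1 b2].
have s2 : 0 <= 4 * s by rewrite mulr_ge0// ltW.
rewrite euclid_le//=.
have h1 : (p'.1 - q'.1) ^+ 2 <= (2 * s) ^+ 2.
  rewrite -real_normK ?num_real// ler_sqr ?nnegrE//; last by rewrite mulr_ge0// ltW.
  by apply: (le_trans (ler_normB _ _)); lra.
have h2 : (p'.2 - q'.2) ^+ 2 <= (2 * s) ^+ 2.
  rewrite -real_normK ?num_real// ler_sqr ?nnegrE//; last by rewrite mulr_ge0// ltW.
  by apply: (le_trans (ler_normB _ _)); lra.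
have := sqr_ge0 s; move: h1 h2; rewrite !exprMn; lra.
Qed.

Lemma diam_gt0 K : 0 < diam (triangle_set K).
Proof.
apply: (lt_le_trans _ (diam_ub (@vertex_in K 0) (@vertex_in K 1))).
rewrite lt_neqAle euclid_ge0 andbT eq_sym; apply/eqP => h.
have := bary_vertex K 0 0; have := bary_vertex K 0 1.
have : vertex K 0 = vertex K 1.
  have := sqr_euclid (vertex K 0 - vertex K 1); rewrite h expr0n /= => /esym/eqP.
  rewrite paddr_eq0 ?sqr_ge0// !sqrf_eq0 !subr_eq0.
  by case: (vertex K 0) (vertex K 1) => ? ? [? ?] /= /andP[/eqP -> /eqP ->].
by move=> <- -> /eqP; rewrite eq_sym oner_eq0.
Qed.

(** Shape regularity is only used through this disc.  A supremum of 0 for the inner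
    diameter is excluded because the diameter of a triangle is positive. *)
Lemma inscribed_disc K (sigma : R) :
  diam (triangle_set K) <= sigma * indiam (triangle_set K) ->
  exists c r, [/\ 0 < r, [set p | euclid (p - c) <= r] `<=` triangle_set K &
    diam (triangle_set K) <= 4 * `|sigma| * r].
Proof.
move=> h; have d0 := diam_gt0 K.
set S := [set d | exists c r, [/\ 0 <= r,
    [set x | euclid (x - c) <= r] `<=` triangle_set K & d = 2 * r]].
have si : 0 < sigma * indiam (triangle_set K) by exact: lt_le_trans h.
have i0 : 0 < indiam (triangle_set K).
  have ige : 0 <= indiam (triangle_set K).
    have [hs|hs] := pselect (has_sup S); last by rewrite /indiam sup_out.
    have [[_ [c [r [r0 cr _]]]] ub] := hs.
    apply: (@le_trans _ _ (2 * r)); first by rewrite mulr_ge0.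
    by apply: ub_le_sup => //; exists c, r.
  by rewrite lt_neqAle ige andbT eq_sym; apply: contraTneq si => ->; rewrite mulr0 ltxx.
have hs : has_sup S.
  by apply: contrapT => ns; move: i0; rewrite /indiam sup_out// ltxx.
have := sup_adherent (ltac:(by rewrite divr_gt0//) : 0 < indiam (triangle_set K) / 2) hs.
move=> [_ [c [r [r0 cr ->]]]]; rewrite -[sup _]/(indiam (triangle_set K)) => h2.
have r2 : indiam (triangle_set K) < 4 * r by move: h2; lra.
exists c, r; split => //; first by move: i0 r2; lra.
apply: (le_trans h); apply: (@le_trans _ _ (`|sigma| * indiam (triangle_set K))).
  by rewrite ler_wpM2r ?ler_norm// ltW.
by rewrite (mulrC 4) -mulrA ler_wpM2l// ltW.
Qed.

(** Compare the values at the two ends of the diameter of the disc in the direction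
    of the gradient. *)
Lemma affine_gradient_le K (a b c m r : R) q : 0 < r ->
  [set p | euclid (p - q) <= r] `<=` triangle_set K ->
  (forall i, `|affine a b c (vertex K i)| <= m) -> euclid (b, c) * r <= m.
Proof.
move=> r0 disc h; set g := euclid (b, c).
have g0 : 0 <= g by exact: euclid_ge0.
have m0 : 0 <= m by exact: le_trans (normr_ge0 _) (h 0).
have [->|gn] := eqVneq g 0; first by rewrite mul0r.
have gp : 0 < g by rewrite lt_neqAle eq_sym gn.
pose s := r / g.
have s0 : 0 <= s by rewrite divr_ge0// ltW.
have gE : b * b + c * c = g * g.
  by have := sqr_euclid (b, c); rewrite -/g /= !expr2.
(* the ends of that diameter are q + s g and q - s g, with g the gradient and s = r / |g| *)
have inT (e : R) : e ^+ 2 = 1 -> triangle_set K (q + (e * s) *: (b, c)).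
  move=> ee; apply: disc => /=; rewrite [X in euclid X](_ : _ = (e * s) *: (b, c)).
    rewrite euclidZ -/g normrM (ger0_norm s0) /s -mulrA divfK//.
    have -> : `|e| = 1 by apply/eqP; rewrite -sqrp_eq1// real_normK ?num_real// ee.
    by rewrite mul1r.
  by rewrite addrAC subrr add0r.
have h1 := affine_le_vertices (inT 1 (expr1n _ _)) h.
have h2 := affine_le_vertices (inT (-1) ltac:(by rewrite sqrrN expr1n)) h.
move: h1 h2; rewrite !ler_norml => /andP[_ h1] /andP[h2 _].
have E1 : affine a b c (q + (1 * s) *: (b, c)) = affine a b c q + s * (g * g).
  by rewrite -gE /affine /= /GRing.scale /=; ring.
have E2 : affine a b c (q + (-1 * s) *: (b, c)) = affine a b c q - s * (g * g).
  by rewrite -gE /affine /= /GRing.scale /=; ring.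
have sg : s * (g * g) = g * r by rewrite /s mulrA divfK// mulrC.
by move: h1 h2; rewrite E1 E2 sg; lra.
Qed.

End TriangleGeometry.

(** * Weak gradients and norms on a triangle *)

Section WeakGradientNorms.
Variable R : realType.
Notation T2 := (measurableTypeR R * measurableTypeR R)%type.
Notation mu := (@lebesgue2 R).
Implicit Types (K : triangle R) (D : set (R * R)).

(** The fundamental lemma in the open triangle; its boundary is negligible. *)
Lemma is_weak_gradient_ae_eq K f G1 G2 :
  is_weak_gradient (triangle_set K) f G1 -> is_weak_gradient (triangle_set K) f G2 ->
  {ae mu, forall p, triangle_set K p -> G1 p = G2 p}.
Proof.
move=> [_ l11 l12 H1] [_ l21 l22 H2].
have mK := @triangle_measurable _ K.
have cK : compact (closed_region (bary_forms K)).
  by rewrite -triangle_closed_region; exact: triangle_compact.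
have d1 : {ae mu, forall p, open_region (bary_forms K) p -> (G1 p).1 - (G2 p).1 = 0}.
  apply: (@du_bois_reymond _ (triangle_set K) _ (fun p => (G1 p).1 - (G2 p).1)) => //.
  - exact: locally_integrable2B l11 l21.
  - move=> psi tp; under eq_Rintegral do rewrite mulrBl.
    rewrite RintegralB//; [|exact: integrable_mul_test mK l11 tp|exact: integrable_mul_test mK l21 tp].
    by apply/eqP; rewrite subr_eq0 -eqr_opp -(H1 _ tp).1 -(H2 _ tp).1.
  - exact: open_triangle_sub.
have d2 : {ae mu, forall p, open_region (bary_forms K) p -> (G1 p).2 - (G2 p).2 = 0}.
  apply: (@du_bois_reymond _ (triangle_set K) _ (fun p => (G1 p).2 - (G2 p).2)) => //.
  - exact: locally_integrable2B l12 l22.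
  - move=> psi tp; under eq_Rintegral do rewrite mulrBl.
    rewrite RintegralB//; [|exact: integrable_mul_test mK l12 tp|exact: integrable_mul_test mK l22 tp].
    by apply/eqP; rewrite subr_eq0 -eqr_opp -(H1 _ tp).2 -(H2 _ tp).2.
  - exact: open_triangle_sub.
apply: (@filterS3 _ _ (ae_filter_ringOfSetsType mu) _ _ _ _ _ d1 d2 (ae_open_triangle K)).
move=> p h1 h2 hK /hK Kp; move: (h1 Kp) (h2 Kp) => /eqP + /eqP.
by rewrite !subr_eq0; case: (G1 p) (G2 p) => ? ? [? ?] /= /eqP -> /eqP ->.
Qed.

Lemma weak_gradientP D f : weakly_differentiable D f ->
  is_weak_gradient D f (weak_gradient D f).
Proof. by move=> h; exact: (@xgetPex _ (cst 0) [set G | is_weak_gradient D f G]). Qed.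

Lemma measurable_euclid D (G : R * R -> R * R) : measurable_fun (D : set T2) (fst \o G) ->
  measurable_fun (D : set T2) (snd \o G) -> measurable_fun (D : set T2) (fun p => euclid (G p)).
Proof.
move=> m1 m2; apply: (@measurableT_comp _ _ _ _ _ _ (@Num.sqrt R)).
  by apply: continuous_measurable_fun; exact: sqrt_continuous.
by apply: measurable_funD; apply: measurable_funX.
Qed.

Lemma eq_Lnorm_on D (q : \bar R) f g : {in D, f =1 g} -> Lnorm_on D q f = Lnorm_on D q g.
Proof.
move=> fg; apply: eq_Lnorm => p /=; rewrite !patchE.
by case: ifPn => // /fg ->.
Qed.

Lemma Lnorm_on_ae_le D (F : R * R -> R) : (Lnorm_on D +oo F < +oo)%E ->
  {ae mu, forall p, D p -> `|F p| <= fine (Lnorm_on D +oo F)}.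
Proof.
have mu0 : (0 < mu setT)%E.
  apply: (@lt_le_trans _ _ (mu (`[0, 1]%classic `*` `[0, 1]%classic))).
    by rewrite lebesgue2_rect ?ler01// subr0 mulr1 lte_fin ltr01.
  apply: le_measure; rewrite ?inE//.
  by apply: measurableX; exact: measurable_itv.
have fin : (0 <= Lnorm_on D +oo F)%E by exact: Lnorm_ge0.
move=> Fy; have /fineK FE : Lnorm_on D +oo F \is a fin_num by rewrite ge0_fin_numE.
have := ess_sup_ge mu (abse \o (EFin \o (F \_ D))).
apply: (@filterS _ _ (ae_filter_ringOfSetsType mu)) => p + Dp.
have -> : ess_sup mu (abse \o (EFin \o (F \_ D))) = Lnorm_on D +oo F.
  by rewrite /Lnorm_on unlock mu0.
by rewrite -FE /= lee_fin patchE mem_set.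
Qed.

Lemma Lnorm_on2E D (F : R * R -> R) :
  Lnorm_on D 2%:E F = ((\int[mu]_(p in D) ((F p) ^+ 2)%:E) `^ 2^-1)%E.
Proof.
rewrite /Lnorm_on unlock; congr (_ `^ _)%E.
rewrite [RHS]integral_mkcond; apply: eq_integral => p _ /=.
rewrite powR_mulrn// real_normK ?num_real// !patchE.
by case: ifPn => // _; rewrite expr0n.
Qed.

Lemma sqrt_poweR (c : R) : 0 <= c -> ((c ^+ 2)%:E `^ 2^-1 = c%:E)%E.
Proof. by move=> c0; rewrite poweR_EFin powR12_sqrt ?sqr_ge0// sqrtr_sqr ger0_norm. Qed.

(** The triangle is contained in a square of half-width its diameter, centred at a
    vertex. *)
Lemma Lnorm_on2_le K (F : R * R -> R) (B : R) :
  measurable_fun (triangle_set K : set T2) F -> 0 <= B ->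
  {ae mu, forall p, triangle_set K p -> `|F p| <= B} ->
  (Lnorm_on (triangle_set K) 2%:E F <= (B * (2 * diam (triangle_set K)))%:E)%E.
Proof.
move=> mF B0 FB; set h := diam _; have h0 : 0 < h := diam_gt0 K.
have mK := @triangle_measurable _ K; set a := vertex K 0.
have hh0 : 0 <= B * (2 * h) by rewrite mulr_ge0// mulr_ge0// ltW.
rewrite Lnorm_on2E -[leRHS]sqrt_poweR//.
apply: gt0_ler_poweR; rewrite ?invr_ge0//.
- by rewrite in_itv /= leey andbT; apply: integral_ge0 => p _; rewrite lee_fin sqr_ge0.
- by rewrite in_itv /= leey andbT lee_fin sqr_ge0.
apply: (@le_trans _ _ (\int[mu]_(p in triangle_set K) (cst (B ^+ 2)%:E) p)%E).
  apply: ae_ge0_le_integral => //.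
  - by move=> p _; rewrite lee_fin sqr_ge0.
  - by apply/measurable_EFinP; exact: measurable_funX.
  - by move=> p _; rewrite lee_fin sqr_ge0.
  - apply: (@filterS _ _ (ae_filter_ringOfSetsType mu) _ _ _ FB) => p hp Kp.
    by rewrite lee_fin -real_normK ?num_real// ler_sqr ?nnegrE// hp.
have -> : ((B * (2 * h)) ^+ 2)%:E = ((B ^+ 2)%:E * ((2 * h) ^+ 2)%:E)%E.
  by rewrite -EFinM exprMn.
rewrite integral_cst//; apply: lee_wpmul2l; first by rewrite lee_fin sqr_ge0.
have <- : mu (`[a.1 - h, a.1 + h]%classic `*` `[a.2 - h, a.2 + h]%classic) = ((2 * h) ^+ 2)%:E.
  by rewrite lebesgue2_rect; [congr EFin; ring|lra|lra].
apply: le_measure; rewrite ?inE//; first by apply: measurableX; exact: measurable_itv.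
move=> p Kp; have pa := diam_ub Kp (@vertex_in _ K 0).
have := le_trans (normr1_le_euclid _) pa; have := le_trans (normr2_le_euclid _) pa.
rewrite !ler_norml /= -/a -/h => /andP[? ?] /andP[? ?].
by split; rewrite /= in_itv /=; apply/andP; split; lra.
Qed.

Lemma Lnorm_on2_ge D (F : R * R -> R) (m t : R) (c : R * R) : measurable (D : set T2) ->
  measurable_fun (D : set T2) F -> 0 <= m -> 0 <= t ->
  `[c.1 - t, c.1 + t]%classic `*` `[c.2 - t, c.2 + t]%classic `<=` D ->
  (forall p, `|p.1 - c.1| <= t -> `|p.2 - c.2| <= t -> m <= `|F p|) ->
  ((m * (2 * t))%:E <= Lnorm_on D 2%:E F)%E.
Proof.
move=> mD mF m0 t0 QD Fm; set Q := _ `*` _ in QD.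
have mQ : measurable (Q : set T2) by apply: measurableX; exact: measurable_itv.
have mt0 : 0 <= m * (2 * t) by rewrite mulr_ge0// mulr_ge0.
have mF2 : measurable_fun (D : set T2) (fun p => ((F p) ^+ 2)%:E).
  by apply/measurable_EFinP; exact: measurable_funX.
rewrite Lnorm_on2E -[leLHS]sqrt_poweR//.
apply: gt0_ler_poweR; rewrite ?invr_ge0//.
- by rewrite in_itv /= leey andbT lee_fin sqr_ge0.
- by rewrite in_itv /= leey andbT; apply: integral_ge0 => p _; rewrite lee_fin sqr_ge0.
apply: (@le_trans _ _ (\int[mu]_(p in Q) ((F p) ^+ 2)%:E)%E); last first.
  by apply: ge0_subset_integral => // p _; rewrite lee_fin sqr_ge0.
have -> : (((m * (2 * t)) ^+ 2)%:E = \int[mu]_(p in Q) (cst (m ^+ 2)%:E) p)%E.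
  rewrite integral_cst// /Q lebesgue2_rect; [|lra|lra].
  by rewrite -EFinM; congr EFin; ring.
apply: ge0_le_integral => //.
- by move=> p _; rewrite lee_fin sqr_ge0.
- exact: measurable_funS mF2.
- move=> p [/=]; rewrite !in_itv /= => /andP[? ?] /andP[? ?].
  rewrite lee_fin -[leRHS]real_normK ?num_real// ler_sqr ?nnegrE//.
  by apply: Fm; rewrite ler_norml; apply/andP; split; lra.
Qed.

End WeakGradientNorms.

Section TriangleEstimate.
Variable R : realType.
Notation T2 := (measurableTypeR R * measurableTypeR R)%type.
Notation mu := (@lebesgue2 R).
Implicit Types (K : triangle R) (p q x y : R * R).

Lemma lipschitzP (A : set (R * R)) (f : R * R -> R) : [lipschitz f x | x in A] ->
  exists2 L : R, 0 <= L & forall x y, A x -> A y -> `|f x - f y| <= L * `|x - y|.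
Proof.
move=> /pinfty_ex_gt0[L L0 h]; exists L; first exact: ltW.
by move=> x y Ax Ay; apply: (h (x, y)); split.
Qed.

(** Extends [weak_gradient_lipschitz] to the boundary by moving both points slightly
    towards the centroid g. *)
Lemma lipschitz_on_triangle K f G (L M : R) :
  is_weak_gradient (triangle_set K) f G -> 0 <= L ->
  (forall x y, triangle_set K x -> triangle_set K y -> `|f x - f y| <= L * `|x - y|) ->
  0 <= M -> {ae mu, forall x, triangle_set K x -> euclid (G x) <= M} ->
  forall x y, triangle_set K x -> triangle_set K y -> `|f x - f y| <= M * euclid (x - y).
Proof.
move=> fG L0 fL M0 GM x y Kx Ky.
have cK : compact (closed_region (bary_forms K)).
  by rewrite -triangle_closed_region; exact: triangle_compact.
have lip := weak_gradient_lipschitz (@triangle_measurable _ K) fG L0 fL M0 GM cK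
  (@open_triangle_sub _ K).
pose g := \sum_i 3^-1 *: vertex K i.
have gi i : lform (bary K i) g = 3^-1.
  rewrite /lform affine_comb; last by rewrite sum_ord3; field.
  rewrite (bigD1 i)//= -/(lform _ _) bary_vertex eqxx mulr1 big1 ?addr0// => j ji.
  by rewrite -/(lform _ _) bary_vertex eq_sym (negbTE ji) mulr0.
have Kg : triangle_set K g by apply/triangle_setP => i; rewrite gi invr_ge0.
have seg p t : triangle_set K p -> 0 < t -> t <= 1 ->
    open_region (bary_forms K) ((1 - t) *: p + t *: g).
  move=> /triangle_setP hp t0 t1 l /mem_bary[i ->].
  have -> : lform (bary K i) ((1 - t) *: p + t *: g) = (1 - t) * lform (bary K i) p + t / 3.
    by rewrite -(gi i) /lform /affine /= /GRing.scale /=; ring.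
  by rewrite ltr_wpDl// ?mulr_ge0 ?subr_ge0// divr_gt0.
have dist p t : 0 < t -> p - ((1 - t) *: p + t *: g) = t *: (p - g).
  by move=> _; rewrite scalerBl scale1r scalerBr -addrA opprD addrA subrr sub0r opprD opprK.
pose S := L * `|x - g| + L * `|y - g| + 1.
have S0 : 0 < S by rewrite /S ltr_wpDl// addr_ge0// mulr_ge0.
apply/ler_addgt0Pr => e e0; pose t := Num.min (e / S) 1.
have t0 : 0 < t by rewrite lt_min divr_gt0//= ltr01.
have t1 : t <= 1 by rewrite ge_min lexx orbT.
have tS : t * S <= e by rewrite -ler_pdivlMr// ge_min lexx.
pose x' := (1 - t) *: x + t *: g; pose y' := (1 - t) *: y + t *: g.
have ox : open_region (bary_forms K) x' by exact: seg.
have oy : open_region (bary_forms K) y' by exact: seg.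
have close p : triangle_set K p -> `|f p - f ((1 - t) *: p + t *: g)| <= t * (L * `|p - g|).
  move=> Kp; apply: (le_trans (fL _ _ Kp (open_triangle_sub (seg _ _ Kp t0 t1)))).
  by rewrite dist// normrZ gtr0_norm// mulrCA.
have h1 := close x Kx; have h2 := close y Ky; have h3 := lip _ _ ox oy.
have h4 : euclid (x' - y') <= euclid (x - y).
  have -> : x' - y' = (1 - t) *: (x - y).
    by rewrite /x' /y' opprD addrACA subrr addr0 scalerBr.
  rewrite euclidZ ger0_norm ?subr_ge0// ler_piMl ?euclid_ge0//.
  by rewrite lerBlDr lerDl ltW.
have h5 : M * euclid (x' - y') <= M * euclid (x - y) by rewrite ler_wpM2l.
have -> : f x - f y = (f x - f x') + (f x' - f y') - (f y - f y') by ring.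
apply: (le_trans (ler_normB _ _)); apply: (le_trans (lerD (ler_normD _ _) (lexx _))).
have SE : t * S = t * (L * `|x - g|) + t * (L * `|y - g|) + t by rewrite /S; ring.
by rewrite -/x' in h1; rewrite -/y' in h2; move: h1 h2 h3 h5 tS t0; rewrite SE; lra.
Qed.

Lemma argmax_vertex (F : 'I_3 -> R) : exists i, forall j, F j <= F i.
Proof.
have [i _ h] := @arg_maxP _ _ 'I_3 0 xpredT F isT.
by exists i => j; exact: h.
Qed.

(** The homothety of ratio 1/4 centred at the vertex i maps the disc into the part of
    the triangle where the weight of the other vertices is at most 1/4; there the
    function is at least 3/4 - 1/4 = 1/2 of its nodal maximum. *)
Lemma Lnorm_on2_affine_ge K (a b c r : R) o i : 0 < r ->
  [set p | euclid (p - o) <= r] `<=` triangle_set K ->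
  (forall j, `|affine a b c (vertex K j)| <= `|affine a b c (vertex K i)|) ->
  ((`|affine a b c (vertex K i)| * r / 8)%:E <=
     Lnorm_on (triangle_set K) 2%:E (affine a b c))%E.
Proof.
move=> r0 disc imax; set V := `|_|; have V0 : 0 <= V by exact: normr_ge0.
set vi := vertex K i; pose o' := (3 / 4) *: vi + (1 / 4) *: o.
(* 4 p - 3 vi is the preimage of p under the homothety; 4 (r / 8) sqrt 2 <= r *)
have near p : `|p.1 - o'.1| <= r / 8 -> `|p.2 - o'.2| <= r / 8 ->
    triangle_set K (4 *: p - 3 *: vi).
  rewrite !ler_norml => /andP[u1 u2] /andP[u3 u4]; apply: disc => /=.
  rewrite euclid_le; last exact: ltW.
  have -> : (4 *: p - 3 *: vi - o).1 = 4 * (p.1 - o'.1).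
    by rewrite /o' /= /GRing.scale /=; field.
  have -> : (4 *: p - 3 *: vi - o).2 = 4 * (p.2 - o'.2).
    by rewrite /o' /= /GRing.scale /=; field.
  have s1 : (p.1 - o'.1) ^+ 2 <= (r / 8) ^+ 2.
    by rewrite -real_normK ?num_real// ler_sqr ?nnegrE ?divr_ge0 ?(ltW r0)// ler_norml u1.
  have s2 : (p.2 - o'.2) ^+ 2 <= (r / 8) ^+ 2.
    by rewrite -real_normK ?num_real// ler_sqr ?nnegrE ?divr_ge0 ?(ltW r0)// ler_norml u3.
  rewrite !exprMn; move: s1 s2 (sqr_ge0 r); rewrite exprMn; lra.
have pE p : p = (1 - 1 / 4) *: vi + (1 / 4) *: (4 *: p - 3 *: vi).
  by case: (p) (vi) => ? ? [? ?]; congr (_, _); rewrite /= /GRing.scale /=; field.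
have -> : V * r / 8 = V / 2 * (2 * (r / 8)) by field.
apply: (@Lnorm_on2_ge _ _ _ _ _ o').
- exact: triangle_measurable.
- apply: continuous_measurable2; first exact: triangle_measurable.
  exact: continuous_affine.
- by rewrite divr_ge0.
- by rewrite divr_ge0// ltW.
- move=> p [/=]; rewrite !in_itv /= => /andP[u1 u2] /andP[u3 u4].
  rewrite (pE p); apply: triangle_convex; [exact: vertex_in| |by apply/andP; split; lra].
  by apply: near; rewrite ler_distl ?u1 ?u2 ?u3 ?u4.
- move=> p u1 u2; have dV := affine_le_vertices (near p u1 u2) imax.
  have -> : affine a b c p = 3 / 4 * affine a b c vi + 1 / 4 * affine a b c (4 *: p - 3 *: vi).
    by rewrite /affine /= /GRing.scale /=; field.
  have VE : `|3 / 4 * affine a b c vi| = 3 / 4 * V by rewrite normrM ger0_norm// divr_ge0.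
  have dE : `|1 / 4 * affine a b c (4 *: p - 3 *: vi)| <= 1 / 4 * V.
    by rewrite normrM ger0_norm ?divr_ge0// ler_wpM2l// divr_ge0.
  by have := lerB_normD (3 / 4 * affine a b c vi) (1 / 4 * affine a b c (4 *: p - 3 *: vi));
    rewrite VE; move: dE; rewrite -/V; lra.
Qed.

End TriangleEstimate.

(** * The interpolation error *)

Section InterpolationError.
Variable R : realType.
Notation T2 := (measurableTypeR R * measurableTypeR R)%type.
Notation mu := (@lebesgue2 R).

Lemma gradient_combination_le (g d1 d2 : R * R) (a b A1 A2 A3 : R) :
  `|a| * euclid g <= A1 -> `|b| * euclid d1 <= A2 -> euclid d2 <= A3 ->
  euclid (a * g.1 + d1.1 * b - d2.1, a * g.2 + d1.2 * b - d2.2) <= A1 + A2 + A3.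
Proof.
move=> h1 h2 h3.
rewrite (_ : (_, _) = a *: g + b *: d1 - d2); last first.
  by case: (g) (d1) (d2) => ? ? [? ?] [? ?]; congr (_, _); rewrite /= /GRing.scale /=; ring.
apply: (le_trans (euclidD _ _)); rewrite euclidN lerD//.
by apply: (le_trans (euclidD _ _)); rewrite !euclidZ lerD.
Qed.

(** The disc supplies shape regularity in the form h <= 4 s r, which trades the
    diameter for the radius in the inverse estimates and in the lower bound on the
    norm of v. *)
Lemma interpolation_error_on_triangle (K : triangle R) (s H : R) (v phi : R * R -> R) :
  0 <= s -> (exists o r, [/\ 0 < r,
    [set p | euclid (p - o) <= r] `<=` triangle_set K &
    diam (triangle_set K) <= 4 * s * r]) ->
  diam (triangle_set K) <= H ->
  affine_on (triangle_set K) v -> in_W1oo (triangle_set K) phi ->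
  let w := fun x => v x * phi x - lagrange_interpolant K (fun y => v y * phi y) x in
  weakly_differentiable (triangle_set K) w /\
  (Lnorm_on (triangle_set K) 2%:E w + H%:E * grad_Lnorm_on (triangle_set K) 2%:E w <=
   (1 + 32 * s * (6 + 16 * s))%:E * H%:E * grad_Lnorm_on (triangle_set K) +oo phi *
   Lnorm_on (triangle_set K) 2%:E v)%E.
Proof.
move=> s0 [cen [r [r0 disc hr]]] hH [va [vb [vc vE]]] [phiL phiW _ phiM] w.
set S := triangle_set K in disc hr hH vE phiL phiW phiM *.
set h := diam S in hr hH; have h0 : 0 < h := diam_gt0 K.
have mS : measurable (S : set T2) := @triangle_measurable _ K.
have [[pa [pb [pc pE]]] pv] := lagrange_interpolantP K (fun y => v y * phi y).
set p := lagrange_interpolant K _ in pE pv w *.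
have vS x : S x -> v x = affine va vb vc x by move=> Sx; exact: vE.
have pA x : p x = affine pa pb pc x by exact: pE.
have wE : {in S, (fun x => affine va vb vc x * phi x - affine pa pb pc x) =1 w}.
  by move=> x /set_mem Sx; rewrite /w pA vS.
pose G := weak_gradient S phi.
have phiG : is_weak_gradient S phi G by exact: weak_gradientP.
have wG := eq_is_weak_gradient wE
  (weak_gradient_affine_product va vb vc pa pb pc mS phiG).
have wW : weakly_differentiable S w by eexists; exact: wG.
split=> //.
have GMae := Lnorm_on_ae_le phiM.
rewrite -/(grad_Lnorm_on S +oo phi) in GMae.
have M0 : (0 <= grad_Lnorm_on S +oo phi)%E by exact: Lnorm_ge0.
have /fineK ME : grad_Lnorm_on S +oo phi \is a fin_num by rewrite ge0_fin_numE.
set M := fine _ in GMae ME; rewrite -ME.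
have {}M0 : 0 <= M by rewrite -lee_fin ME.
have GM : {ae mu, forall x, S x -> euclid (G x) <= M}.
  apply: (@filterS _ _ (ae_filter_ringOfSetsType mu) _ _ _ GMae) => x hx Sx.
  exact: le_trans (ler_norm _) (hx Sx).
have [L L0 fL] := lipschitzP phiL.
have lip := lipschitz_on_triangle phiG L0 fL M0 GM.
set f0 := phi (vertex K 0).
have osc x : S x -> `|phi x - f0| <= M * h.
  move=> Sx; apply: (le_trans (lip _ _ Sx (@vertex_in _ K 0))).
  by rewrite ler_wpM2l// diam_ub//; exact: vertex_in.
have [i imax] := argmax_vertex (fun j => `|affine va vb vc (vertex K j)|).
set V := `|affine va vb vc (vertex K i)| in imax.
have V0 : 0 <= V by exact: normr_ge0.
have Mh0 : 0 <= M * h by rewrite mulr_ge0// ltW.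
have vV x : S x -> `|affine va vb vc x| <= V by move=> Sx; exact: affine_le_vertices Sx imax.
(* the interpolant q of v (phi - f0), small because the nodal values of phi - f0 are *)
pose qa := pa - f0 * va; pose qb := pb - f0 * vb; pose qc := pc - f0 * vc.
have qE x : affine qa qb qc x = p x - f0 * affine va vb vc x.
  by rewrite pA /affine /qa /qb /qc; ring.
have qV j : `|affine qa qb qc (vertex K j)| <= V * (M * h).
  rewrite qE pv vS; last exact: vertex_in.
  rewrite [f0 * _]mulrC -mulrBr normrM ler_pM//.
  by apply: osc; exact: vertex_in.
have gv : euclid (vb, vc) * r <= V by exact: affine_gradient_le r0 disc imax.
have gq : euclid (qb, qc) * r <= V * (M * h) by exact: affine_gradient_le r0 disc qV.
have gvh : M * h * euclid (vb, vc) <= 4 * s * V * M.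
  have e0 : 0 <= M * euclid (vb, vc) by rewrite mulr_ge0// euclid_ge0.
  apply: (@le_trans _ _ (M * euclid (vb, vc) * (4 * s * r))).
    by rewrite mulrAC ler_wpM2l.
  have -> : M * euclid (vb, vc) * (4 * s * r) = 4 * s * M * (euclid (vb, vc) * r) by ring.
  by rewrite [leRHS]mulrAC ler_wpM2l// mulr_ge0// mulr_ge0.
have gqh : euclid (qb, qc) <= 4 * s * V * M.
  rewrite -(ler_pM2r r0); apply: (le_trans gq).
  have -> : 4 * s * V * M * r = V * (M * (4 * s * r)) by ring.
  by rewrite ler_wpM2l// ler_wpM2l.
have phi_meas : measurable_fun (S : set T2) phi by case: phiG => -[].
have aff_meas a b c : measurable_fun (S : set T2) (affine a b c).
  by apply: continuous_measurable2 => //; exact: continuous_affine.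
have w_meas : measurable_fun (S : set T2) w.
  by have [[]] := wG.
have w_le x : S x -> `|w x| <= 2 * V * (M * h).
  move=> Sx; rewrite -(wE x) ?inE// -pA.
  have -> : affine va vb vc x * phi x - p x =
      affine va vb vc x * (phi x - f0) - affine qa qb qc x by rewrite qE; ring.
  apply: (le_trans (ler_normB _ _)); rewrite normrM.
  have := ler_pM (normr_ge0 _) (normr_ge0 _) (vV x Sx) (osc x Sx).
  have := affine_le_vertices Sx qV.
  by move=> u1 u2; move: (lerD u2 u1); lra.
have w_norm : (Lnorm_on S 2%:E w <= (2 * V * (M * h) * (2 * h))%:E)%E.
  apply: Lnorm_on2_le => //; first by rewrite mulr_ge0// mulr_ge0.
  by apply: aeW => x; exact: w_le.
pose Gw := weak_gradient S w.
have GwG : is_weak_gradient S w Gw by exact: weak_gradientP.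
have Gw_meas : measurable_fun (S : set T2) (fun x => euclid (Gw x)).
  by have [_ [m1 _] [m2 _] _] := GwG; exact: measurable_euclid.
have Gw_le : {ae mu, forall x, S x -> `|euclid (Gw x)| <= V * M * (1 + 8 * s)}.
  apply: (@filterS2 _ _ (ae_filter_ringOfSetsType mu) _ _ _ _ GM (is_weak_gradient_ae_eq GwG wG)).
  move=> x hG hx Sx; rewrite (ger0_norm (euclid_ge0 _)) (hx Sx).
  have -> : (affine va vb vc x * (G x).1 + vb * phi x - pb,
             affine va vb vc x * (G x).2 + vc * phi x - pc) =
    (affine va vb vc x * (G x).1 + (vb, vc).1 * (phi x - f0) - (qb, qc).1,
     affine va vb vc x * (G x).2 + (vb, vc).2 * (phi x - f0) - (qb, qc).2).
    by rewrite /qb /qc /=; congr (_, _); ring.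
  have -> : V * M * (1 + 8 * s) = V * M + 4 * s * V * M + 4 * s * V * M by ring.
  apply: gradient_combination_le => //.
  - by apply: ler_pM => //; [exact: euclid_ge0|exact: vV|exact: hG].
  - by apply: le_trans gvh; rewrite ler_wpM2r ?euclid_ge0// osc.
have VMs0 : 0 <= V * M * (1 + 8 * s) by rewrite mulr_ge0 ?mulr_ge0// addr_ge0// mulr_ge0.
have Gw_norm : (grad_Lnorm_on S 2%:E w <= (V * M * (1 + 8 * s) * (2 * h))%:E)%E.
  exact: Lnorm_on2_le.
have v_norm : ((V * r / 8)%:E <= Lnorm_on S 2%:E v)%E.
  rewrite (@eq_Lnorm_on _ _ _ _ (affine va vb vc)); last by move=> x /set_mem; exact: vS.
  exact: Lnorm_on2_affine_ge disc imax.
have H0 : 0 <= H by apply: le_trans hH; exact: ltW.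
have C0 : 0 <= 1 + 32 * s * (6 + 16 * s).
  by rewrite addr_ge0// mulr_ge0 ?mulr_ge0// addr_ge0// mulr_ge0.
apply: (@le_trans _ _ (2 * V * (M * h) * (2 * h) + H * (V * M * (1 + 8 * s) * (2 * h)))%:E).
  rewrite [X in (_ <= X)%E]EFinD; apply: leeD; first exact: w_norm.
  by rewrite [X in (_ <= X)%E]EFinM; apply: lee_wpmul2l; [rewrite lee_fin|exact: Gw_norm].
apply: (@le_trans _ _ ((1 + 32 * s * (6 + 16 * s)) * H * M * (V * r / 8))%:E); last first.
  rewrite -[(_%:E * H%:E)%E]EFinM -[(_%:E * M%:E)%E]EFinM [X in (X <= _)%E]EFinM.
  apply: lee_wpmul2l; last exact: v_norm.
  by rewrite lee_fin mulr_ge0// mulr_ge0.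
rewrite lee_fin.
have VM0 : 0 <= V * M by rewrite mulr_ge0.
have k1 : V * M * (h * h) <= V * M * (H * h) by rewrite ler_wpM2l// ler_wpM2r// ltW.
have k2 : H * (V * M) * (6 + 16 * s) * h <= H * (V * M) * (6 + 16 * s) * (4 * s * r).
  by rewrite ler_wpM2l// mulr_ge0 ?mulr_ge0// addr_ge0// mulr_ge0.
have k3 : 0 <= H * (V * M) * r by rewrite !mulr_ge0// ltW.
(* both sides are compared through H V M h, using h <= H and h <= 4 s r *)
have E1 : 2 * V * (M * h) * (2 * h) + H * (V * M * (1 + 8 * s) * (2 * h)) =
  4 * (V * M * (h * h)) + H * (V * M) * (2 + 16 * s) * h by ring.
have E2 : H * (V * M) * (6 + 16 * s) * h = 4 * (V * M * (H * h)) + H * (V * M) * (2 + 16 * s) * h.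
  by ring.
have E3 : (1 + 32 * s * (6 + 16 * s)) * H * M * (V * r / 8) =
  H * (V * M) * r / 8 + H * (V * M) * (6 + 16 * s) * (4 * s * r) by field.
rewrite E1 E3; move: k1 k2 k3; rewrite E2; lra.
Qed.

End InterpolationError.

Theorem lemma2 (R : realType) (F : set (mesh (@unit_square R)))
    (F_regular : shape_regular F) :
  exists C : R, 0 < C /\
    forall (T : mesh (@unit_square R)), F T -> mesh_size T < 1 ->
    forall (v : R * R -> R), fe_space T v ->
    forall (i : 'I_(mesh_card T)) (phi : R * R -> R),
    let K := triangle_set (T i) in
    in_W1oo K phi ->
    let w := fun x => v x * phi x -
      lagrange_interpolant (T i) (fun y => v y * phi y) x in
    weakly_differentiable K w /\
    (Lnorm_on K 2%:E w + (mesh_size T)%:E * grad_Lnorm_on K 2%:E w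
     <= C%:E * (mesh_size T)%:E * grad_Lnorm_on K +oo phi * Lnorm_on K 2%:E v)%E.
Proof.
have [sigma regular] := F_regular; set s := `|sigma|.
have s0 : 0 <= s by exact: normr_ge0.
exists (1 + 32 * s * (6 + 16 * s)); split.
  by rewrite ltr_pwDl// mulr_ge0 ?mulr_ge0// addr_ge0// mulr_ge0.
move=> T FT _ v [_ v_affine] i phi K phiW.
apply: interpolation_error_on_triangle => //.
- by apply: inscribed_disc; exact: regular.
- exact: (@le_bigmax _ _ _ 0 (fun j => diam (triangle_set (T j))) i).
Qed.
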